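(* Let $S>0$. The closure of $\{D_x:x\in\mathcal H_S\}$ in the topology of locally uniform convergence on $\mathbb C$ is $$\mathfrak D_S=\Big\{e^{\tau z}\prod_j(1+zx_j):\ x\in\mathcal H_S,\ \tau\ge0,\ \sum_jx_j+\tau\le S\Big\}.$$ The parameters $(x,\tau)$ are unique. This is also the coefficient completion of the finite spectra (finitely supported $x\in\mathcal H_S$), and coefficientwise and locally uniform convergence agree on this bounded class. Write $D_{x,\tau}(z)=e^{\tau z}\prod_j(1+zx_j)$. If $x^{(l)}\in\mathcal H_S$ and $D_{x^{(l)}}\to D_{x,\tau}$, then $x_j^{(l)}\to x_j$ for every $j$ and $$\tau=\lim_l\sum_jx_j^{(l)}-\sum_jx_j=\lim_{M\to\infty}\lim_l\sum_{j>M}x_j^{(l)}.$$ For such a convergent sequence the following are equivalent: $\tau=0$; $\lim_M\sup_l\sum_{j>M}x_j^{(l)}=0$; and $\|x^{(l)}-x\|_{\ell^1}\to0$.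
   Context: $\mathcal H_S=\{x_1\ge x_2\ge\cdots\ge0:\ \sum_jx_j\le S\}$ and $D_x(z)=\prod_j(1+zx_j)$, an entire function of $z\in\mathbb C$. *)

(* Defs.v *)
From mathcomp Require Import all_boot all_order all_algebra.
From mathcomp Require Import complex.
From mathcomp Require Import all_classical all_reals all_analysis.
Set Implicit Arguments.
Unset Strict Implicit.
Unset Printing Implicit Defensive.
Import Order.TTheory GRing.Theory Num.Theory.
Import numFieldNormedType.Exports.
Local Open Scope classical_set_scope.
Local Open Scope ring_scope.
Local Open Scope complex_scope.

(* R[i], packaged so that its norm topology is inferred. *)
Definition Cplx (R : realType) : numFieldType := R[i].

Definition toC (R : realType) (r : R) : Cplx R := r%:C.

Section Spectra.
Variable R : realType.
Implicit Types (x : nat -> R) (S tau : R).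

(* Sequences are indexed from 0: [x j] stands for x_{j+1}, so [tail_mass M x]
   is the sum of the terms x_j of 1-based index j > M. *)
Definition tail_mass (M : nat) x : R := \big[+%R/0]_(M <= j <oo) x j.

Definition total_mass x : R := tail_mass 0 x.

Definition HS S : set (nat -> R) :=
  [set x : nat -> R | [/\ nonincreasing_seq x, forall j, 0 <= x j,
               cvgn (series x) & total_mass x <= S]].

Definition finite_spectra S : set (nat -> R) :=
  HS S `&` [set x : nat -> R | finite_set [set j | x j != 0]].

Definition expC (z : Cplx R) : Cplx R :=
  limn (series (fun n => z ^+ n / (n`!)%:R)).

Definition Dx x (z : Cplx R) : Cplx R :=
  \big[*%R/1]_(0 <= j <oo) (1 + z * toC (x j)).

Definition Dxtau x tau (z : Cplx R) : Cplx R := expC (toC tau * z) * Dx x z.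

Definition params S : set ((nat -> R) * R) :=
  [set p | [/\ HS S p.1, 0 <= p.2 & total_mass p.1 + p.2 <= S]].

Definition DS S : set (Cplx R -> Cplx R) :=
  [set Dxtau p.1 p.2 | p in params S].

(* The coefficients a_k of the expansion f(z) = sum_k a_k z^k on the whole
   plane; they exist and are unique for f entire.  The default value 0 is
   only used when f has no such expansion. *)
Definition coefs (f : Cplx R -> Cplx R) : nat -> Cplx R :=
  xget (fun _ => 0)
    [set a | forall z, series (fun k => a k * z ^+ k) @ \oo --> f z].

End Spectra.

Arguments coefs {R} f _.

(* Main.v *)
Require Import Defs.
From HB Require Import structures.
From mathcomp Require Import all_boot all_order all_algebra.
From mathcomp Require Import complex.
From mathcomp Require Import all_classical all_reals all_analysis.
From mathcomp Require Import ring lra.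
Import Order.TTheory GRing.Theory Num.Theory.
Import numFieldNormedType.Exports.
Local Open Scope classical_set_scope.
Local Open Scope ring_scope.
Set Implicit Arguments.
Unset Strict Implicit.
Unset Printing Implicit Defensive.

(** The parameters are traded for a pair with better compactness: (x, sigma),
    where sigma = sum_j x_j + tau.  On such pairs the core of the theorem is the
    fact that a continuous injection of a compact space into a Hausdorff
    space is a homeomorphism onto its image.

    The entire function D_{x,tau} has Taylor coefficients between 0 and S^k/k!.
    Its n-th truncation keeps the factors 1 + z x_j with j < n and concentrates
    all remaining mass into one exponential, giving
    prod_{j<n} (1 + z x_j) e^{(sigma - x_0 - ... - x_{n-1}) z}.  Replacing e^{az}
    by 1 + az lowers coefficients by at most a^2 times those of z^2 e^{az}; as x
    is nonincreasing with sum at most S, the squares of the x_j with j >= n add up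
    to at most S^2/(n+1), so truncations converge uniformly over all parameters
    ([trunc_coeff_near]).  A truncation involves finitely many parameters
    continuously, hence the coefficients are continuous in (x, sigma) for
    coordinatewise convergence ([cvg_spec_coeff]).  The pairs (x, sigma) form a
    compact set ([spectrum_compact]): mass of x that escapes to infinity is lost
    by sum_j x_j but kept by sigma, and this loss is tau.  The map is injective
    ([spec_coeff_inj]): when x_0 > 0 the zero of D_{x,tau} closest to 0 is -1/x_0,
    so x_0 is determined, its factor can be cancelled, and one continues with the
    remaining sequence; sigma is the coefficient of z.  Consequently convergence of
    the coefficients forces x_j^{(l)} -> x_j and sigma^{(l)} -> sigma
    ([cvg_spec_coeff_inv]).

    Coefficientwise and locally uniform convergence agree because the
    coefficients are dominated by those of e^{Sz}: in one direction by splitting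
    off a uniformly small tail ([has_sum_cvg_uniform]), in the other by reading
    the coefficients successively from values at small real arguments
    ([has_sum_coef_cvg]).

    Both closures are contained in the stated sets by compactness, and fill them
    because D_{x,tau} is the limit of the polynomials obtained by cutting x after
    n terms and spreading the remaining mass over n + 1 equal entries
    ([finite_spectra_dense]).

    For a convergent sequence, sum_{j>M} x_j^{(l)} is sigma^{(l)} minus a partial
    sum, so it tends to tau + sum_{j>M} x_j; the assertions on tails and on the
    l^1 distance are elementary consequences. *)

(** * Coefficients of products of linear factors with an exponential *)

Section Coefficients.
Context {R : realType}.
Implicit Types (a b t S sigma : R) (c d x : nat -> R) (s : seq R) (k n : nat).

(** The Taylor coefficients of (1 + a z) f(z), where c lists those of f. *)
Definition mul_lin a c k : R := c k + (if k is j.+1 then a * c j else 0).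

Definition mul_lins s c : nat -> R := foldr mul_lin c s.

(** Multiplication by z^2 on coefficient sequences. *)
Definition shift2 c k : R := if k is j.+2 then c j else 0.

Lemma mul_lin_le a c d : 0 <= a -> (forall k, c k <= d k) ->
  forall k, mul_lin a c k <= mul_lin a d k.
Proof.
move=> a0 cd [|k]; rewrite /mul_lin ?lerD//.
exact: ler_wpM2l.
Qed.

Lemma mul_lin_ge0 a c : 0 <= a -> (forall k, 0 <= c k) ->
  forall k, 0 <= mul_lin a c k.
Proof. by move=> a0 c0 [|k]; rewrite /mul_lin addr_ge0// mulr_ge0. Qed.

Lemma mul_lin_inj a : injective (mul_lin a).
Proof.
move=> c d cd; apply/funext; elim => [|k IH].
  by move/(congr1 (@^~ 0%N)): cd; rewrite /mul_lin !addr0.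
by move/(congr1 (@^~ k.+1)): cd; rewrite /mul_lin IH => /addIr.
Qed.

Lemma mul_lin_shift2 a c k : mul_lin a (shift2 c) k = shift2 (mul_lin a c) k.
Proof.
by case: k => [|[|[|k]]]; rewrite /mul_lin /shift2 ?mulr0 ?addr0.
Qed.

Lemma mul_linD a q c d k :
  mul_lin a (fun k => c k + q * d k) k = mul_lin a c k + q * mul_lin a d k.
Proof. case: k => [|k]; rewrite /mul_lin; ring. Qed.

Lemma mul_lins_le s c d : all (>= 0) s -> (forall k, c k <= d k) ->
  forall k, mul_lins s c k <= mul_lins s d k.
Proof.
move=> + cd; elim: s => [//|b s IH] /= /andP[b0 s0].
by apply: mul_lin_le => //; exact: IH.
Qed.

Lemma mul_lins_ge0 s c : all (>= 0) s -> (forall k, 0 <= c k) ->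
  forall k, 0 <= mul_lins s c k.
Proof.
move=> + c0; elim: s => [//|b s IH] /= /andP[b0 s0].
by apply: mul_lin_ge0 => //; exact: IH.
Qed.

(** Multiplying by linear factors is linear and commutes with multiplication by
    z^2: this carries an error term of second order through a product. *)
Lemma mul_lins_shift2 s q c d k :
  mul_lins s (fun k => c k + q * shift2 d k) k
  = mul_lins s c k + q * shift2 (mul_lins s d) k.
Proof.
elim: s k => [//|b s IH] k /=; rewrite -mul_lin_shift2 -mul_linD.
by congr (mul_lin b _ k); apply/funext => j; rewrite IH.
Qed.

Lemma shift2_le c d : (forall k, c k <= d k) ->
  forall k, shift2 c k <= shift2 d k.
Proof. by move=> cd [|[|k]] /=. Qed.

Lemma shift2_ge0 c : (forall k, 0 <= c k) -> forall k, 0 <= shift2 c k.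
Proof. by move=> c0 [|[|k]] /=. Qed.

Lemma le_exp_coeff t t' k : 0 <= t -> t <= t' -> exp_coeff t k <= exp_coeff t' k.
Proof.
move=> t0 tt'; rewrite /exp_coeff /= ler_wpM2r ?invr_ge0//.
exact: lerXn2r (le_trans t0 tt') tt'.
Qed.

Lemma exp_coeffS t k :
  exp_coeff t k.+1 = t ^+ k.+1 / (k.+1%:R * k`!%:R).
Proof. by rewrite /exp_coeff /= factS natrM. Qed.

(** The first two terms of the binomial expansion. *)
Lemma expr_add_lb t a k : 0 <= t -> 0 <= a ->
  t ^+ k.+1 + k.+1%:R * a * t ^+ k <= (t + a) ^+ k.+1.
Proof.
move=> t0 a0; elim: k => [|k IH]; first by rewrite !expr1 expr0 !mulr1 mul1r.
rewrite [leRHS]exprSr; apply: le_trans (ler_wpM2r (addr_ge0 t0 a0) IH).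
have h : 0 <= k.+1%:R * a ^+ 2 * t ^+ k by rewrite !mulr_ge0 ?exprn_ge0.
rewrite -subr_ge0; apply: le_trans h _; rewrite le_eqVlt; apply/orP; left.
apply/eqP; rewrite !exprS -(natr1 k.+1); ring.
Qed.

(** Taylor's formula for the power function, with remainder bounded at the
    right end point. *)
Lemma expr_add_ub t a k : 0 <= t -> 0 <= a ->
  (t + a) ^+ k.+2 <= t ^+ k.+2 + k.+2%:R * a * t ^+ k.+1
                     + k.+2%:R * k.+1%:R * a ^+ 2 * (t + a) ^+ k.
Proof.
move=> t0 a0; elim: k => [|k IH].
  rewrite expr0 -subr_ge0 (_ : _ - _ = a ^+ 2) ?exprn_ge0// !exprS; ring.
have h : a ^+ 2 * t ^+ k.+1 <= 2 * a ^+ 2 * (t + a) ^+ k.+1.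
  rewrite -mulrA mulrCA ler_wpM2l ?exprn_ge0//.
  apply: (@le_trans _ _ ((t + a) ^+ k.+1)).
    by apply: lerXn2r; rewrite ?nnegrE ?addr_ge0// lerDl.
  by rewrite ler_peMl ?exprn_ge0 ?addr_ge0// ler1n.
rewrite [leLHS]exprSr; apply: le_trans (ler_wpM2r (addr_ge0 t0 a0) IH) _.
have {}h := ler_wpM2l (ler0n R k.+2) h.
rewrite -subr_ge0; rewrite -subr_ge0 in h; apply: le_trans h _.
rewrite le_eqVlt; apply/orP; left.
apply/eqP; rewrite !exprS -!natr1; ring.
Qed.

(** Coefficientwise, 1 + a z is at most e^{a z}. *)
Lemma exp_coeffD_lb t a k : 0 <= t -> 0 <= a ->
  mul_lin a (exp_coeff t) k <= exp_coeff (t + a) k.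
Proof.
move=> t0 a0; case: k => [|k]; first by rewrite /mul_lin /exp_coeff/= !expr0 addr0.
rewrite /mul_lin !exp_coeffS /exp_coeff/=.
have /ler_wpM2r h := expr_add_lb k t0 a0.
apply: le_trans (h (k.+1%:R * k`!%:R)^-1 _); last first.
  by rewrite invr_ge0 mulr_ge0.
have k1 : k.+1%:R != 0 :> R by rewrite pnatr_eq0.
have k2 : k`!%:R != 0 :> R by rewrite pnatr_eq0 -lt0n fact_gt0.
rewrite le_eqVlt; apply/orP; left; apply/eqP.
field; by rewrite nat1r k1 k2.
Qed.

(** Coefficientwise, e^{a z} - 1 - a z is at most a^2 z^2 e^{a z}; both sides are
    multiplied by e^{t z} here. *)
Lemma exp_coeffD_ub t a k : 0 <= t -> 0 <= a ->
  exp_coeff (t + a) k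
  <= mul_lin a (exp_coeff t) k + a ^+ 2 * shift2 (exp_coeff (t + a)) k.
Proof.
move=> t0 a0; case: k => [|[|k]].
- by rewrite /mul_lin /exp_coeff/= !expr0 mulr0 !addr0.
- by rewrite /mul_lin /exp_coeff/= !expr1 expr0 mulr0 addr0 !divr1 mulr1.
rewrite /mul_lin /shift2 !exp_coeffS /exp_coeff/= factS natrM.
have /ler_wpM2r h := expr_add_ub k t0 a0.
apply: le_trans (h (k.+2%:R * (k.+1%:R * k`!%:R))^-1 _) _.
  by rewrite invr_ge0 !mulr_ge0.
have k0 : k.+2%:R != 0 :> R by rewrite pnatr_eq0.
have k1 : k.+1%:R != 0 :> R by rewrite pnatr_eq0.
have k2 : k`!%:R != 0 :> R by rewrite pnatr_eq0 -lt0n fact_gt0.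
rewrite le_eqVlt; apply/orP; left; apply/eqP.
move: k0 k1 k2 => + + +; rewrite -!(natr1 k.+1) -!(natr1 k) => k0 k1 k2.
by field; rewrite ?k0 ?k1 ?k2.
Qed.

Definition sqsum s : R := \sum_(b <- s) b ^+ 2.

Lemma sum_ge0 s : all (>= 0) s -> 0 <= \sum_(b <- s) b.
Proof. by move=> /allP s0; rewrite big_seq sumr_ge0. Qed.

Lemma sqsum_ge0 s : 0 <= sqsum s.
Proof. by rewrite sumr_ge0// => b _; rewrite sqr_ge0. Qed.

Lemma mul_lins_exp_le s t : 0 <= t -> all (>= 0) s ->
  forall k, mul_lins s (exp_coeff t) k <= exp_coeff (t + \sum_(b <- s) b) k.
Proof.
move=> t0; elim: s => [|b s IH] /=; first by rewrite big_nil addr0.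
move=> /andP[b0 s0] k; rewrite big_cons (addrC b) addrA.
apply: le_trans (exp_coeffD_lb _ _ b0); last by rewrite addr_ge0 ?sum_ge0.
exact: mul_lin_le b0 (IH s0) k.
Qed.

(** The errors of [exp_coeffD_ub] add up: exchanging the factors 1 + b z of a
    list for exponentials costs the sum of the squares b^2. *)
Lemma mul_lins_exp_ge s t : 0 <= t -> all (>= 0) s ->
  forall k, exp_coeff (t + \sum_(b <- s) b) k
    <= mul_lins s (exp_coeff t) k
       + sqsum s * shift2 (exp_coeff (t + \sum_(b <- s) b)) k.
Proof.
move=> t0; elim: s => [|b s IH] /=.
  by move=> _ k; rewrite /sqsum !big_nil mul0r !addr0.
move=> /andP[b0 s0] k; rewrite /sqsum !big_cons (addrC b) addrA.
have ts0 : 0 <= t + \sum_(b <- s) b by rewrite addr_ge0 ?sum_ge0.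
apply: le_trans (exp_coeffD_ub _ ts0 b0) _.
rewrite mulrDl addrCA -/(sqsum s) [leLHS]addrC lerD2l.
apply: le_trans (mul_lin_le b0 (IH s0) k) _.
rewrite mul_linD lerD2l mul_lin_shift2 ler_wpM2l ?sqsum_ge0//.
by apply: shift2_le => j; exact: exp_coeffD_lb.
Qed.

End Coefficients.

(** * The space of spectra and its coefficient functions *)

Section Spectrum.
Context {R : realType}.
Implicit Types (a b t S sigma : R) (c d x : nat -> R) (s : seq R) (k n : nat).

(** A spectrum (x, tau) recorded as x and sigma = sum_j x_j + tau.  All
    conditions are on finitely many entries at a time, hence closed under
    coordinatewise limits; the condition tau >= 0 becomes the bound of the
    partial sums by sigma. *)
Definition spectrum S x sigma : Prop :=
  [/\ nonincreasing_seq x, forall j, 0 <= x j,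
      forall n, series x n <= sigma & sigma <= S].

(** Coefficients of the truncation that keeps the first n factors and puts the
    rest of the mass sigma in one exponential. *)
Definition trunc_coeff x sigma n : nat -> R :=
  mul_lins (mkseq x n) (exp_coeff (sigma - series x n)).

(** The Taylor coefficients of D_{x,tau}, as [has_sum_spec] shows. *)
Definition spec_coeff x sigma k : R := limn (fun n => trunc_coeff x sigma n k).

Lemma sum_mkseq x n : \sum_(b <- mkseq x n) b = series x n.
Proof. by rewrite big_map /series /= /index_iota subn0. Qed.

Lemma mkseqD x n m : mkseq x (n + m) = mkseq x n ++ [seq x j | j <- iota n m].
Proof. by rewrite /mkseq iotaD map_cat. Qed.

Lemma mul_lins_cat s s' c : mul_lins (s ++ s') c = mul_lins s (mul_lins s' c).
Proof. by rewrite /mul_lins foldr_cat. Qed.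

(** The first j + 1 entries are all at least x_j, and their sum is at most S. *)
Lemma spectrum_le S x sigma j : spectrum S x sigma -> x j <= S / j.+1%:R.
Proof.
move=> [xd x0 xs sS]; rewrite ler_pdivlMr//.
apply: le_trans sS; apply: le_trans (xs j.+1); rewrite /series /= big_mkord.
rewrite mulr_natr -[X in _ *+ X]card_ord -sumr_const ler_sum// => i _.
by apply: xd; rewrite -ltnS.
Qed.

Lemma spectrum_sigma_ge0 S x sigma : spectrum S x sigma -> 0 <= sigma.
Proof. by move=> [_ _ /(_ 0%N) + _]; rewrite /series /= big_geq. Qed.

Lemma spectrum_S_ge0 S x sigma : spectrum S x sigma -> 0 <= S.
Proof. by move=> h; case: (h) => _ _ _; apply: le_trans (spectrum_sigma_ge0 h). Qed.

Lemma trunc_coeff_ge0 S x sigma n k : spectrum S x sigma -> 0 <= trunc_coeff x sigma n k.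
Proof.
move=> [_ x0 xs _]; apply: mul_lins_ge0.
  by apply/allP => _ /mapP[j _ ->] /=.
by move=> j; rewrite exp_coeff_ge0// subr_ge0.
Qed.

(** The cost of exchanging a block s2 of linear factors for an exponential is
    governed by its sum of squares, uniformly in the other factors. *)
Lemma mul_lins_block S (s1 s2 : seq R) t k : 0 <= t -> all (>= 0) s1 -> all (>= 0) s2 ->
  t + \sum_(b <- s2) b + \sum_(b <- s1) b <= S ->
  mul_lins (s1 ++ s2) (exp_coeff t) k
    <= mul_lins s1 (exp_coeff (t + \sum_(b <- s2) b)) k
    <= mul_lins (s1 ++ s2) (exp_coeff t) k + sqsum s2 * shift2 (exp_coeff S) k.
Proof.
move=> t0 s10 s20 leS; rewrite mul_lins_cat; apply/andP; split.
  by apply: mul_lins_le => // j; exact: mul_lins_exp_le.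
apply: le_trans (mul_lins_le s10 (mul_lins_exp_ge t0 s20) k) _.
rewrite mul_lins_shift2 lerD2l ler_wpM2l ?sqsum_ge0//.
have ts0 : 0 <= t + \sum_(b <- s2) b by rewrite addr_ge0// sum_ge0.
apply: shift2_le => j; apply: le_trans (mul_lins_exp_le ts0 s10 j) _.
by apply: le_exp_coeff => //; rewrite addr_ge0// sum_ge0.
Qed.

Lemma mkseq_ge0 x n : (forall j, 0 <= x j) -> all (>= 0) (mkseq x n).
Proof. by move=> x0; apply/allP => _ /mapP[j _ ->] /=. Qed.

(** The squares of the entries from n to m add up to at most x_n S, and
    [spectrum_le] bounds x_n by S/(n+1). *)
Lemma trunc_coeff_step S x sigma n m k : spectrum S x sigma -> (n <= m)%N ->
  trunc_coeff x sigma m k <= trunc_coeff x sigma n k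
  <= trunc_coeff x sigma m k + S ^+ 2 / n.+1%:R * shift2 (exp_coeff S) k.
Proof.
move=> h nm; case: (h) => xd x0 xs sS; have S0 := spectrum_S_ge0 h.
have {nm}[l ->] : exists l, m = (n + l)%N by exists (m - n)%N; rewrite subnKC.
set t := sigma - series x (n + l).
have t0 : 0 <= t by rewrite subr_ge0.
set s2 := [seq x j | j <- iota n l].
have s20 : all (>= 0) s2 by apply/allP => _ /mapP[j _ ->] /=.
have s10 := mkseq_ge0 n x0.
have tE : sigma - series x n = t + \sum_(b <- s2) b.
  rewrite /t -!sum_mkseq mkseqD big_cat /=; ring.
have leS : t + \sum_(b <- s2) b + \sum_(b <- mkseq x n) b <= S.
  by rewrite -tE sum_mkseq subrK.
have := mul_lins_block k t0 s10 s20 leS.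
rewrite -tE -mkseqD => /andP[h1 h2]; rewrite /trunc_coeff h1 /=.
apply: le_trans h2 _; rewrite lerD2l ler_wpM2r//.
  by apply: shift2_ge0 => j; rewrite exp_coeff_ge0.
rewrite /sqsum big_map expr2 mulrAC.
apply: (@le_trans _ _ (S / n.+1%:R * \sum_(b <- s2) b)).
  rewrite big_map mulr_sumr !big_seq; apply: ler_sum => j.
  rewrite mem_iota => /andP[nj _]; rewrite expr2 ler_wpM2r//.
  by apply: le_trans (spectrum_le n h); apply: xd.
rewrite ler_wpM2l ?divr_ge0//; apply: le_trans sS.
apply: le_trans (xs (n + l)%N).
by rewrite -sum_mkseq mkseqD big_cat /= lerDr sum_ge0.
Qed.

Lemma trunc_coeff_nonincreasing S x sigma k : spectrum S x sigma ->
  nonincreasing_seq (fun n => trunc_coeff x sigma n k).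
Proof. by move=> h n m nm; have /andP[] := trunc_coeff_step k h nm. Qed.

Lemma trunc_coeff_cvg S x sigma k : spectrum S x sigma ->
  (fun n => trunc_coeff x sigma n k) @ \oo --> spec_coeff x sigma k.
Proof.
move=> h; apply: nonincreasing_is_cvgn.
  exact: trunc_coeff_nonincreasing h.
by exists 0 => _ [n _ <-]; exact: trunc_coeff_ge0 h.
Qed.

(** The quality of the approximation does not depend on the spectrum. *)
Lemma trunc_coeff_near S x sigma n k : spectrum S x sigma ->
  spec_coeff x sigma k <= trunc_coeff x sigma n k
  <= spec_coeff x sigma k + S ^+ 2 / n.+1%:R * shift2 (exp_coeff S) k.
Proof.
move=> h; have c := @trunc_coeff_cvg _ _ _ k h; apply/andP; split.
  apply: nonincreasing_cvgn_ge; last exact: (cvgP _ c).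
  exact: trunc_coeff_nonincreasing h.
rewrite -lerBlDr; apply: limr_ge; first exact: (cvgP _ c).
exists n => // m /= nm.
by rewrite lerBlDr; have /andP[] := trunc_coeff_step k h nm.
Qed.

Lemma spec_coeff_ge0 S x sigma k : spectrum S x sigma -> 0 <= spec_coeff x sigma k.
Proof.
move=> h; apply: limr_ge; first exact: (cvgP _ (trunc_coeff_cvg h)).
by apply: nearW => n; exact: trunc_coeff_ge0 h.
Qed.

Lemma spec_coeff_le S x sigma k : spectrum S x sigma ->
  spec_coeff x sigma k <= exp_coeff S k.
Proof.
move=> h; have /andP[+ _] := trunc_coeff_near 0 k h; move/le_trans; apply.
rewrite /trunc_coeff /series/= big_geq// subr0; apply: le_exp_coeff.
  exact: spectrum_sigma_ge0 h.
by case: h.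
Qed.

Lemma mul_lins0 s c : mul_lins s c 0 = c 0%N.
Proof. by elim: s => //= b s IH; rewrite /mul_lin addr0. Qed.

Lemma mul_lins1 s c : mul_lins s c 1 = c 1%N + (\sum_(b <- s) b) * c 0%N.
Proof.
elim: s => /= [|b s IH]; first by rewrite big_nil mul0r addr0.
rewrite /mul_lin IH mul_lins0 big_cons; ring.
Qed.

Lemma spec_coeff1 x sigma : spec_coeff x sigma 1 = sigma.
Proof.
rewrite /spec_coeff (_ : (fun _ => _) = cst sigma) ?lim_cst//.
apply/funext => n; rewrite /trunc_coeff mul_lins1 sum_mkseq /exp_coeff /=.
by rewrite expr1 expr0 !divr1 mulr1 subrK.
Qed.

(** Factoring out 1 + x_0 z leaves the series of the shifted spectrum. *)
Lemma spec_coeff_shift S x sigma : spectrum S x sigma ->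
  spectrum S (x \o succn) (sigma - x 0%N) /\
  spec_coeff x sigma = mul_lin (x 0%N) (spec_coeff (x \o succn) (sigma - x 0%N)).
Proof.
move=> h; case: (h) => xd x0 xs sS.
have serS n : series (x \o succn) n = series x n.+1 - x 0%N.
  by rewrite /series /= big_nat_recl// addrC addKr.
have h' : spectrum S (x \o succn) (sigma - x 0%N).
  split => [m n mn|j|n|]; rewrite ?serS ?lerD2r//=; first exact: xd.
  by apply: le_trans sS; rewrite gerBl.
split=> //; apply/funext => k.
have := @trunc_coeff_cvg _ _ _ k h; rewrite -cvg_shiftS => /cvg_lim <- //.
apply/cvg_lim => //.
have -> : (fun n => trunc_coeff x sigma n.+1 k) =
    (fun n => mul_lin (x 0%N) (trunc_coeff (x \o succn) (sigma - x 0%N) n) k).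
  apply/funext => n; rewrite /trunc_coeff serS opprB addrA subrK.
  congr (mul_lin _ (foldr _ _ _) k).
  by rewrite -[LHS]/(map x (iota (1 + 0) n)) iotaDl -map_comp.
case: k => [|k]; rewrite /mul_lin.
  by rewrite addr0; under eq_fun do rewrite addr0; exact: trunc_coeff_cvg h'.
apply: cvgD; first exact: trunc_coeff_cvg h'.
by apply: cvgMl_tmp; exact: trunc_coeff_cvg h'.
Qed.

Section Continuity.
Context {T : Type} {F : set_system T} {FF : Filter F}.
Context (xs : T -> nat -> R) (sigmas : T -> R) (x : nat -> R) (sigma : R).
Context (xs_cvg : forall j, xs t j @[t --> F] --> x j).
Context (sigmas_cvg : sigmas @ F --> sigma).

Lemma cvg_mul_lins (r : seq nat) (cs : T -> nat -> R) c :
  (forall k, cs t k @[t --> F] --> c k) ->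
  forall k, mul_lins (map (xs t) r) (cs t) k @[t --> F] --> mul_lins (map x r) c k.
Proof.
move=> cs_cvg; elim: r => [//|j r IH] /= [|k]; rewrite /mul_lin.
  by rewrite addr0; under eq_fun do rewrite addr0; exact: IH.
by apply: cvgD => //; apply: cvgM.
Qed.

Lemma cvg_series_fin n : series (xs t) n @[t --> F] --> series x n.
Proof.
rewrite /series /=; apply: cvg_big => [|i _]; first exact: add_continuous.
exact: xs_cvg.
Qed.

Lemma cvg_exp_coeff_param k : exp_coeff (sigmas t) k @[t --> F] --> exp_coeff sigma k.
Proof.
rewrite /exp_coeff /=; apply: cvgMr_tmp.
elim: k => [|k IH]; first exact: cvg_cst.
under eq_fun do rewrite exprS.
by rewrite exprS; apply: cvgM.
Qed.

End Continuity.

Lemma cvg_trunc_coeff T (F : set_system T) {FF : Filter F} (xs : T -> nat -> R) sigmas x sigma n k :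
  (forall j, xs t j @[t --> F] --> x j) -> sigmas @ F --> sigma ->
  trunc_coeff (xs t) (sigmas t) n k @[t --> F] --> trunc_coeff x sigma n k.
Proof.
move=> xs_cvg s_cvg; apply: cvg_mul_lins => // j.
have h : (fun t : T => sigmas t - series (xs t) n) @ F --> sigma - series x n.
  by apply: cvgB => //; exact: cvg_series_fin.
exact (@cvg_exp_coeff_param _ _ _ _ _ h j).
Qed.

(** A uniform limit of continuous functions is continuous, applied to the
    truncations. *)
Lemma cvg_spec_coeff T (F : set_system T) {FF : Filter F} S
    (xs : T -> nat -> R) sigmas x sigma :
  (\forall t \near F, spectrum S (xs t) (sigmas t)) -> spectrum S x sigma ->
  (forall j, xs t j @[t --> F] --> x j) -> sigmas @ F --> sigma ->
  forall k, spec_coeff (xs t) (sigmas t) k @[t --> F] --> spec_coeff x sigma k.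
Proof.
move=> hs h xs_cvg s_cvg k; apply/cvgrPdist_le => /= e e0.
pose C := S ^+ 2 * shift2 (exp_coeff S) k.
(* both truncation errors are at most C / (n + 1), whatever t *)
have [n Cn] : exists n : nat, C / n.+1%:R <= e / 4.
  have : C * harmonic n @[n --> \oo] --> C * 0 by apply: cvgMl_tmp; exact: cvg_harmonic.
  rewrite mulr0 => /cvgrPdist_le /(_ (e / 4) ltac:(by rewrite divr_gt0)) [n _ /(_ n)].
  rewrite /= sub0r normrN => /(_ (leqnn n)) ?; exists n.
  exact: le_trans (ler_norm _) _.
have /cvgrPdist_le /(_ (e / 4) ltac:(by rewrite divr_gt0)) A :=
  @cvg_trunc_coeff _ _ FF _ _ _ _ n k xs_cvg s_cvg.
near=> t.
have ht : spectrum S (xs t) (sigmas t) by near: t.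
have At : `|trunc_coeff x sigma n k - trunc_coeff (xs t) (sigmas t) n k| <= e / 4 by near: t.
have /andP[a1 a2] := trunc_coeff_near n k h.
have /andP[b1 b2] := trunc_coeff_near n k ht.
move: a2 b2; rewrite mulrAC -/C => a2 b2.
move: At; rewrite !ler_norml => /andP[At1 At2].
move: (C / n.+1%:R) Cn a2 b2 => D Cn a2 b2.
by apply/andP; split; lra.
Unshelve. all: by end_near. Qed.

Lemma ultra_cvg_itv T (F : set_system T) (f : T -> R) (a b : R) :
  UltraFilter F -> (\forall t \near F, a <= f t <= b) ->
  exists l : R, f @ F --> l.
Proof.
move=> FU fab; have := @segment_compact R a b; rewrite compact_ultra.
have UF : UltraFilter (f @ F).
  split; first exact: fmap_proper_filter.
  move=> G PG sFG; apply/seteqP; split => // A GA.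
  have [//|FnA] := in_ultra_setVsetC (f @^-1` A) FU.
  have /sFG : (f @ F) (~` A) by [].
  by move=> /(filterI GA); rewrite setICr => /filter_ex[].
move=> /(_ (f @ F) UF) [|l [_ fl]]; last by exists l.
by apply: filterS fab => t; rewrite /= in_itv.
Qed.

Lemma ler_cvg_filter T (F : set_system T) {FF : ProperFilter F} (f g : T -> R) l l' :
  f @ F --> l -> g @ F --> l' -> (\forall t \near F, f t <= g t) -> l <= l'.
Proof.
move=> fl gl fg; rewrite -subr_ge0.
apply: (cvgr_to_ge (cvgB gl fl)).
by apply: filterS fg => t; rewrite /= subr_ge0.
Qed.

(** Each coordinate lies in [0, S], so it converges along an ultrafilter, and
    the conditions defining a spectrum pass to the limit. *)
Lemma spectrum_compact T (F : set_system T) S (xs : T -> nat -> R) sigmas :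
  UltraFilter F -> (\forall t \near F, spectrum S (xs t) (sigmas t)) ->
  exists x sigma, [/\ spectrum S x sigma,
    forall j, xs t j @[t --> F] --> x j & sigmas @ F --> sigma].
Proof.
move=> FU hs.
have xl j : exists l : R, xs t j @[t --> F] --> l.
  apply: (@ultra_cvg_itv _ _ _ 0 S) => //; apply: filterS hs => t h.
  case: (h) => xd x0 _ _; rewrite x0 /=.
  apply: le_trans (spectrum_le j h) _.
  by rewrite ler_piMr ?(spectrum_S_ge0 h)// invf_le1 ?ler1n.
have [sigma s_cvg] : exists l : R, sigmas @ F --> l.
  apply: (@ultra_cvg_itv _ _ _ 0 S) => //; apply: filterS hs => t h.
  by rewrite (spectrum_sigma_ge0 h); case: h.
have [x xs_cvg] := choice xl.
exists x, sigma; split=> //; split.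
- move=> m n mn; apply: ler_cvg_filter (xs_cvg n) (xs_cvg m) _.
  by apply: filterS hs => t [xd _ _ _]; exact: xd.
- move=> j; apply: ler_cvg_filter (cvg_cst 0) (xs_cvg j) _.
  by apply: filterS hs => t [].
- move=> n; have sc : (fun t : T => series (xs t) n) @ F --> series x n.
    exact: cvg_series_fin.
  apply: ler_cvg_filter sc s_cvg _.
  by apply: filterS hs => t [].
- apply: ler_cvg_filter s_cvg (cvg_cst S) _.
  by apply: filterS hs => t [].
Qed.

End Spectrum.

(** * Convergence in the complex plane *)

Arguments toC R r : simpl never.

Section ComplexPlane.
Context {R : realType}.
Local Notation C := (Cplx R).
Implicit Types (z w : C) (r : R).

Lemma toC_is_additive : additive (@toC R).
Proof. by move=> r s; exact: (rmorphB (real_complex R)). Qed.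
Lemma toC_is_multiplicative : multiplicative (@toC R).
Proof. exact: (rmorphismMP (real_complex R)). Qed.
HB.instance Definition _ := GRing.isAdditive.Build R C (@toC R) toC_is_additive.
HB.instance Definition _ := GRing.isMultiplicative.Build R C (@toC R) toC_is_multiplicative.

(** The modulus as an element of R; the norm of the field R[i] takes its values
    in R[i] itself. *)
Definition nrm z : R := complex.ComplexField.Normc.normc z.

Arguments nrm : simpl never.

Lemma normCE z : `|z| = toC (nrm z).
Proof. by []. Qed.

Lemma toC_le r s : (toC r <= toC s) = (r <= s).
Proof. exact: lecR. Qed.

Lemma toC_lt r s : (toC r < toC s) = (r < s).
Proof. exact: ltcR. Qed.

Lemma toC_inj : injective (@toC R).
Proof. exact: complexI. Qed.

Lemma nrm_toC r : nrm (toC r) = `|r|.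
Proof. by rewrite /nrm /toC /= expr0n addr0 sqrtr_sqr. Qed.

Lemma nrmM z w : nrm (z * w) = nrm z * nrm w.
Proof. exact: ComplexField.Normc.normcM. Qed.

Lemma nrm_ge0 z : 0 <= nrm z.
Proof. by rewrite -toC_le rmorph0 -normCE. Qed.

Lemma nrmD z w : nrm (z + w) <= nrm z + nrm w.
Proof. by rewrite -toC_le rmorphD -!normCE ler_normD. Qed.

Lemma nrmN z : nrm (- z) = nrm z.
Proof. by apply: toC_inj; rewrite -!normCE normrN. Qed.

Lemma nrmB z w : nrm (z - w) = nrm (w - z).
Proof. by rewrite -nrmN opprB. Qed.

Lemma nrm0 : nrm 0 = 0.
Proof. by apply: toC_inj; rewrite -normCE normr0 rmorph0. Qed.

Lemma nrm1 : nrm 1 = 1.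
Proof. by apply: toC_inj; rewrite -normCE normr1 rmorph1. Qed.

Lemma nrmX z n : nrm (z ^+ n) = nrm z ^+ n.
Proof. by elim: n => [|n IH]; rewrite ?expr0 ?nrm1// !exprS nrmM IH. Qed.

Lemma nrm_sum I (s : seq I) (P : pred I) (f : I -> C) :
  nrm (\sum_(i <- s | P i) f i) <= \sum_(i <- s | P i) nrm (f i).
Proof. by rewrite -toC_le rmorph_sum -normCE; exact: ler_norm_sum. Qed.

Lemma gt0_toC (e : C) : 0 < e -> exists2 r, 0 < r & e = toC r.
Proof.
move=> e0; have /complex_realP[r er] : e \is Num.real by rewrite gtr0_real.
by exists r; rewrite ?er// -toC_lt -[toC r]er rmorph0.
Qed.

(** The positive elements of R[i] are the positive reals, so real radii suffice. *)
Lemma cvgC_distP T (F : set_system T) {FF : Filter F} (f : T -> C) (l : C) :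
  f @ F --> l <-> forall e : R, 0 < e -> \forall t \near F, nrm (l - f t) <= e.
Proof.
split=> [/cvgrPdist_le fl e e0|fl].
  have /fl : 0 < toC e by rewrite -(rmorph0 (@toC R)) toC_lt.
  by apply: filterS => t; rewrite normCE toC_le.
apply/cvgrPdist_le => /= _ /gt0_toC[e e0 ->].
by apply: filterS (fl e e0) => t; rewrite normCE toC_le.
Qed.

Lemma cvg_toC T (F : set_system T) {FF : Filter F} (f : T -> R) (l : R) :
  f @ F --> l <-> (fun t : T => toC (f t)) @ F --> toC l.
Proof.
split=> [/cvgrPdist_le fl|/cvgC_distP fl].
  by apply/cvgC_distP => e /fl; apply: filterS => t; rewrite -rmorphB nrm_toC.
by apply/cvgrPdist_le => e /fl; apply: filterS => t; rewrite -rmorphB nrm_toC.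
Qed.

Lemma cvgC_unique T (F : set_system T) {FF : ProperFilter F} (f : T -> C) (l l' : C) :
  f @ F --> l -> f @ F --> l' -> l = l'.
Proof. exact: norm_cvg_unique. Qed.

Lemma nrm_cvg_le T (F : set_system T) {FF : ProperFilter F} (f : T -> C) (l : C) w b :
  f @ F --> l -> (\forall t \near F, nrm (f t - w) <= b) -> nrm (l - w) <= b.
Proof.
move=> /cvgC_distP fl fb; apply/ler_addgt0Pr => e e0.
have [t [h1 h2]] := filter_ex (filterI fb (fl e e0)).
rewrite -(subrK (f t) l) -addrA addrC; apply: le_trans (nrmD _ _) _.
exact: lerD.
Qed.

Lemma nrm_ge_Re z : `|complex.Re z| <= nrm z.
Proof. rewrite -toC_le; exact: normc_ge_Re. Qed.

Lemma nrm_ge_Im z : `|complex.Im z| <= nrm z.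
Proof.
case: z => a b; rewrite /nrm /= -sqrtr_sqr ler_wsqrtr// lerDr sqr_ge0//.
Qed.

Lemma nrm_le_ReIm z : nrm z <= `|complex.Re z| + `|complex.Im z|.
Proof.
case: z => a b; rewrite /nrm /=.
rewrite -[leRHS]ger0_norm ?addr_ge0// -sqrtr_sqr ler_wsqrtr// sqrrD.
by rewrite !real_normK ?num_real// addrAC lerDl mulrn_wge0// mulr_ge0.
Qed.

(** Comparison test: the real and imaginary parts converge absolutely. *)
Lemma series_domC (u : nat -> C) (v : nat -> R) :
  (forall k, nrm (u k) <= v k) -> cvgn (series v) ->
  exists2 L : C, series u @ \oo --> L &
    forall n, nrm (L - series u n) <= limn (series v) - series v n.
Proof.
move=> uv cv.
have v0 k : 0 <= v k by exact: le_trans (nrm_ge0 _) (uv k).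
have cRe : cvgn (series (fun k => complex.Re (u k))).
  apply: normed_cvg; apply: series_le_cvg cv => //= k; rewrite ?normr_ge0 //.
  exact: le_trans (nrm_ge_Re _) (uv k).
have cIm : cvgn (series (fun k => complex.Im (u k))).
  apply: normed_cvg; apply: series_le_cvg cv => //= k; rewrite ?normr_ge0 //.
  exact: le_trans (nrm_ge_Im _) (uv k).
pose L : C := Complex (limn (series (fun k => complex.Re (u k))))
  (limn (series (fun k => complex.Im (u k)))).
have uL : series u @ \oo --> L.
  apply/cvgC_distP => e e0.
  have /cvgrPdist_le /(_ (e / 2) ltac:(by rewrite divr_gt0)) h1 := cRe.
  have /cvgrPdist_le /(_ (e / 2) ltac:(by rewrite divr_gt0)) h2 := cIm.
  have reE n : complex.Re (series u n) = series (fun k => complex.Re (u k)) n.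
    by rewrite /series /=; elim/big_rec2 : _ => [//|i y1 y2 _ <-]; case: (u i) (y2) => ? ? [].
  have imE n : complex.Im (series u n) = series (fun k => complex.Im (u k)) n.
    by rewrite /series /=; elim/big_rec2 : _ => [//|i y1 y2 _ <-]; case: (u i) (y2) => ? ? [].
  near=> n; apply: le_trans (nrm_le_ReIm _) _.
  have -> : complex.Re (L - series u n) = complex.Re L - complex.Re (series u n).
    by case: (series u n).
  have -> : complex.Im (L - series u n) = complex.Im L - complex.Im (series u n).
    by case: (series u n).
  by rewrite reE imE (splitr e) lerD//; near: n.
exists L => // n.
apply: (nrm_cvg_le uL); exists n => // m /= nm.
rewrite -(subnKC nm) addnC series_addn addrC addKr.
apply: le_trans (nrm_sum _ _ _) _; apply: le_trans (ler_sum _ (fun k _ => uv k)) _.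
rewrite lerBrDl -series_addn.
apply: nondecreasing_cvgn_le => //; exact: nondecreasing_series.
Unshelve. all: by end_near. Qed.

End ComplexPlane.

Arguments nrm : simpl never.

(** * Power series with dominated coefficients *)

Section PowerSeries.
Context {R : realType}.
Local Notation C := (Cplx R).
Implicit Types (z w : C) (a : nat -> C) (c : nat -> R).

Definition has_sum a z (L : C) : Prop :=
  series (fun k => a k * z ^+ k) @ \oo --> L.

Definition dominated (S : R) a : Prop := forall k, nrm (a k) <= exp_coeff S k.

Lemma cvg_series_exp (r : R) : series (exp_coeff r) @ \oo --> expR r.
Proof. exact: is_cvg_series_exp_coeff. Qed.

Lemma has_sum_unique a z (L L' : C) : has_sum a z L -> has_sum a z L' -> L = L'.
Proof. exact: cvgC_unique. Qed.

Lemma dominated_term S a z rho k : dominated S a -> nrm z <= rho ->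
  nrm (a k * z ^+ k) <= exp_coeff (S * rho) k.
Proof.
move=> dom zr; rewrite nrmM nrmX /exp_coeff /= exprMn mulrAC.
apply: ler_pM; rewrite ?nrm_ge0 ?exprn_ge0 ?nrm_ge0//.
by apply: lerXn2r; rewrite ?nnegrE ?(le_trans _ zr) ?nrm_ge0.
Qed.

Lemma dominated_has_sum S a : dominated S a ->
  forall z, exists2 L, has_sum a z L &
    forall n rho, nrm z <= rho ->
      nrm (L - series (fun k => a k * z ^+ k) n)
      <= expR (S * rho) - series (exp_coeff (S * rho)) n.
Proof.
move=> dom z.
have [L aL _] := series_domC (fun k => dominated_term k dom (lexx (nrm z)))
  (@is_cvg_series_exp_coeff _ _).
exists L => // n rho zr.
have [L' aL'] := series_domC (fun k => dominated_term k dom zr)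
  (@is_cvg_series_exp_coeff _ _).
by rewrite (has_sum_unique aL aL'); apply.
Qed.

(** Tannery's theorem, uniformly on discs: beyond some index N all the series
    have tails below that of e^{S rho}, and the finitely many terms before N
    converge. *)
Lemma has_sum_cvg_uniform T (F : set_system T) {FF : Filter F} S (rho e : R)
    (as_ : T -> nat -> C) a (fs : T -> C -> C) (f : C -> C) :
  (\forall t \near F, dominated S (as_ t)) -> dominated S a ->
  (\forall t \near F, forall z, has_sum (as_ t) z (fs t z)) ->
  (forall z, has_sum a z (f z)) ->
  (forall k, as_ t k @[t --> F] --> a k) -> 0 < e ->
  \forall t \near F, forall z, nrm z <= rho -> nrm (f z - fs t z) <= e.
Proof.
move=> doms dom sums sum cv e0.
have [rho0|rho0] := ltP rho 0.
  apply: nearW => t z /(le_trans (nrm_ge0 z)); by rewrite leNgt rho0.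
have /cvgrPdist_le /(_ (e / 4) ltac:(by rewrite divr_gt0)) [N _ /(_ N (leqnn N))] :=
  @cvg_series_exp (S * rho).
move=> /(le_trans (ler_norm _)) /= tail.
have head : \forall t \near F,
    \sum_(0 <= k < N) nrm (a k - as_ t k) * rho ^+ k <= e / 2.
  have : \sum_(0 <= k < N) nrm (a k - as_ t k) * rho ^+ k @[t --> F]
      --> \sum_(0 <= k < N) 0 * rho ^+ k.
    apply: cvg_big => [|k _]; first exact: add_continuous.
    apply: cvgMr_tmp; apply/cvgrPdist_le => /= d d0.
    move: (cv k) => /cvgC_distP /(_ _ d0); apply: filterS => t.
    by rewrite sub0r normrN ger0_norm ?nrm_ge0.
  under [X in _ --> X -> _]eq_bigr do rewrite mul0r.
  rewrite big1_eq => /cvgrPdist_le /(_ (e / 2) ltac:(by rewrite divr_gt0)).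
  by apply: filterS => t; rewrite sub0r normrN => /(le_trans (ler_norm _)).
near=> t => z zr.
have domt : dominated S (as_ t) by near: t.
have sumt : forall z, has_sum (as_ t) z (fs t z) by near: t.
have [L aL /(_ N rho zr) h1] := dominated_has_sum dom z.
have [L' aL' /(_ N rho zr) h2] := dominated_has_sum domt z.
rewrite (has_sum_unique aL (sum z)) in h1.
rewrite (has_sum_unique aL' (sumt z)) in h2.
have h3 : nrm (series (fun k => a k * z ^+ k) N - series (fun k => as_ t k * z ^+ k) N)
    <= e / 2.
  rewrite /series /= -sumrB; apply: le_trans (nrm_sum _ _ _) _.
  apply: (@le_trans _ _ (\sum_(0 <= k < N) nrm (a k - as_ t k) * rho ^+ k)).
    apply: ler_sum => k _; rewrite -mulrBl nrmM nrmX ler_wpM2l ?nrm_ge0//.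
    by apply: lerXn2r; rewrite ?nnegrE ?nrm_ge0.
  by near: t.
set A := series _ N in h1 h3; set B := series _ N in h2 h3.
have -> : f z - fs t z = (f z - A) + ((A - B) + (B - fs t z)) by ring.
apply: le_trans (nrmD _ _) _; apply: le_trans (lerD (lexx _) (nrmD _ _)) _.
rewrite (nrmB B).
move: (nrm _) (nrm _) (nrm _) (expR _ - _) h1 h2 h3 tail => p q r s; lra.
Unshelve. all: by end_near. Qed.

Lemma has_sum_cvg_pt T (F : set_system T) {FF : Filter F} S
    (as_ : T -> nat -> C) a (fs : T -> C) (f : C) z :
  (\forall t \near F, dominated S (as_ t)) -> dominated S a ->
  (\forall t \near F, has_sum (as_ t) z (fs t)) -> has_sum a z f ->
  (forall k, as_ t k @[t --> F] --> a k) -> fs @ F --> f.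
Proof.
move=> doms dom sums sum cv; apply/cvgC_distP => e e0.
(* sums at all points, so that the uniform statement applies *)
have tot b : exists g : C -> C, dominated S b -> forall z, has_sum b z (g z).
  have [db|db] := pselect (dominated S b).
    have ex w : exists L, has_sum b w L.
      by have [L bL _] := dominated_has_sum db w; exists L; exact: bL.
    by have [g hg] := choice ex; exists g => _; exact: hg.
  by exists id => db'; case: (db db').
have [g hg] := choice tot.
have := @has_sum_cvg_uniform _ F FF S (nrm z) e as_ a (fun t => g (as_ t)) (g a)
  doms dom _ (hg a dom) cv e0.
move=> h; near=> t.
have domt : dominated S (as_ t) by near: t.
have st : has_sum (as_ t) z (fs t) by near: t.
rewrite (has_sum_unique sum (hg a dom z)) (has_sum_unique st (hg _ domt z)).
suff : forall w, nrm w <= nrm z -> nrm (g a w - g (as_ t) w) <= e by apply.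
by near: t; apply: h; apply: filterS doms => t' /hg.
Unshelve. all: by end_near. Qed.

(** Induction on k.  At a small real r, once the terms of index below k are
    subtracted, a_k r^k is known up to an error of order r^{k+1} that is common
    to the whole family. *)
Lemma has_sum_coef_cvg T (F : set_system T) {FF : Filter F} (B : R)
    (as_ : T -> nat -> C) a (fs : T -> C -> C) (f : C -> C) :
  (\forall t \near F, forall k, nrm (as_ t k) <= B) -> (forall k, nrm (a k) <= B) ->
  (\forall t \near F, forall z, has_sum (as_ t) z (fs t z)) ->
  (forall z, has_sum a z (f z)) ->
  (forall z, fs t z @[t --> F] --> f z) ->
  forall k, as_ t k @[t --> F] --> a k.
Proof.
move=> bds bd sums sum cv k.
have B0 : 0 <= B by exact: le_trans (nrm_ge0 _) (bd 0%N).
elim/ltn_ind: k => k IH; apply/cvgC_distP => e e0.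
(* r <= 1/2 bounds the geometric tails by 2 B r^(k+1); two such tails must not
   exceed (e / 2) r^k *)
pose r := Num.min (1 / 2) (e / (8 * (B + 1))).
have d0 : 0 < 8 * (B + 1) by lra.
have r0 : 0 < r by rewrite lt_min divr_gt0//= divr_gt0.
have r12 : r <= 1 / 2 by rewrite ge_min lexx.
have re : 8 * (B + 1) * r <= e.
  by rewrite mulrC -ler_pdivlMr// ge_min lexx orbT.
have tailb b (g : C -> C) : (forall k, nrm (b k) <= B) ->
    (forall z, has_sum b z (g z)) ->
    nrm (g (toC r) - series (fun j => b j * toC r ^+ j) k.+1) <= 2 * B * r * r ^+ k.
  move=> bB bg.
  have r1 : `|r| < 1 by rewrite ger0_norm ?ltW//; lra.
  have gc := @cvg_geometric_series _ B r r1.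
  have bv j : nrm (b j * toC r ^+ j) <= geometric B r j.
    by rewrite nrmM nrmX nrm_toC (ger0_norm (ltW r0)) ler_wpM2r ?exprn_ge0// ltW.
  have [L bL /(_ k.+1)] := series_domC bv (cvgP _ gc).
  rewrite (has_sum_unique bL (bg (toC r))) (cvg_lim _ gc)//; move=> h.
  apply: le_trans h _; rewrite geometric_seriesE ?lt_eqF//; last by lra.
  have -> : B / (1 - r) - B * (1 - r ^+ k.+1) / (1 - r) = B * r * r ^+ k / (1 - r).
    by rewrite exprS; field; lra.
  rewrite ler_pdivrMr; last lra.
  have -> : 2 * B * r * r ^+ k * (1 - r) = B * r * r ^+ k * (2 * (1 - r)) by ring.
  by rewrite ler_peMr ?mulr_ge0 ?exprn_ge0 ?(ltW r0)//; lra.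
have rk0 : 0 < r ^+ k by rewrite exprn_gt0.
have head : \forall t \near F,
    \sum_(0 <= j < k) nrm (a j - as_ t j) * r ^+ j <= e / 4 * r ^+ k.
  have : \sum_(0 <= j < k) nrm (a j - as_ t j) * r ^+ j @[t --> F]
      --> \sum_(0 <= j < k) 0 * r ^+ j.
    rewrite !big_nat.
    under eq_cvg do rewrite big_nat.
    apply: cvg_big => [|j jk]; first exact: add_continuous.
    apply: cvgMr_tmp; apply/cvgrPdist_le => /= d d0'.
    move: (IH j jk) => /cvgC_distP /(_ _ d0'); apply: filterS => t.
    by rewrite sub0r normrN ger0_norm ?nrm_ge0.
  under [X in _ --> X -> _]eq_bigr do rewrite mul0r.
  rewrite big1_eq => /cvgrPdist_le /(_ (e / 4 * r ^+ k) ltac:(by rewrite mulr_gt0// divr_gt0)).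
  by apply: filterS => t; rewrite sub0r normrN => /(le_trans (ler_norm _)).
have val : \forall t \near F, nrm (f (toC r) - fs t (toC r)) <= e / 4 * r ^+ k.
  by have /cvgC_distP := cv (toC r); apply; rewrite mulr_gt0// divr_gt0.
near=> t.
have bt : forall k, nrm (as_ t k) <= B by near: t.
have st : forall z, has_sum (as_ t) z (fs t z) by near: t.
have ht : \sum_(0 <= j < k) nrm (a j - as_ t j) * r ^+ j <= e / 4 * r ^+ k by near: t.
have vt : nrm (f (toC r) - fs t (toC r)) <= e / 4 * r ^+ k by near: t.
have h1 := tailb a f bd sum.
have h2 := tailb (as_ t) (fs t) bt st.
move: h1 h2; rewrite !seriesSr.
set A := series _ k; set A' := series _ k => h1 h2.
have h3 : nrm (A - A') <= e / 4 * r ^+ k.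
  rewrite /A /A' /series /= -sumrB; apply: le_trans ht.
  apply: le_trans (nrm_sum _ _ _) _; apply: ler_sum => j _.
  by rewrite -mulrBl nrmM nrmX nrm_toC (ger0_norm (ltW r0)).
suff h : nrm (a k - as_ t k) * r ^+ k <= e * r ^+ k by rewrite ler_pM2r in h.
have -> : nrm (a k - as_ t k) * r ^+ k = nrm ((a k - as_ t k) * toC r ^+ k).
  by rewrite nrmM nrmX nrm_toC (ger0_norm (ltW r0)).
have -> : (a k - as_ t k) * toC r ^+ k = (f (toC r) - fs t (toC r))
    - ((f (toC r) - (A + a k * toC r ^+ k)) - (fs t (toC r) - (A' + as_ t k * toC r ^+ k))
       + (A - A')) by ring.
apply: le_trans (nrmD _ _) _; rewrite nrmN.
apply: le_trans (lerD (lexx _) (nrmD _ _)) _.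
apply: le_trans (lerD (lexx _) (lerD (nrmD _ _) (lexx _))) _; rewrite nrmN.
have : 2 * B * r * r ^+ k + 2 * B * r * r ^+ k <= e / 2 * r ^+ k.
  have -> : 2 * B * r * r ^+ k + 2 * B * r * r ^+ k = (4 * B * r) * r ^+ k by ring.
  rewrite ler_pM2r//; nra.
move: vt h3 h1 h2.
move: (nrm _) (nrm _) (nrm _) (nrm _) => p1 p2 p3 p4; lra.
Unshelve. all: by end_near. Qed.

(** The case of a constant family in [has_sum_coef_cvg]; convergence at 1 makes
    the coefficients bounded. *)
Lemma has_sum_inj a b (f : C -> C) :
  (forall z, has_sum a z (f z)) -> (forall z, has_sum b z (f z)) -> a = b.
Proof.
have bnd (c : nat -> C) : (forall z, has_sum c z (f z)) -> exists B : R, forall k, nrm (c k) <= B.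
  move=> /(_ 1); rewrite /has_sum => cs.
  have : (fun k => c k * 1 ^+ k) @ \oo --> (0 : C).
    by apply: cvg_series_cvg_0; apply: cvgP cs.
  move=> /cvgC_distP /(_ 1 ltr01)[N _ h].
  exists (1 + \sum_(j < N) nrm (c j)) => k.
  have s0 (P : pred 'I_N) : 0 <= \sum_(j < N | P j) nrm (c j).
    by apply: sumr_ge0 => j _; exact: nrm_ge0.
  have [kN|/h] := ltnP k N.
    rewrite (bigD1 (Ordinal kN)) //= addrCA lerDl addr_ge0//.
  by rewrite /= expr1n mulr1 sub0r nrmN => /le_trans; apply; rewrite lerDl.
move=> sa sb; have [Ba hA] := bnd a sa; have [Bb hB] := bnd b sb.
apply/funext => k.
have h : (fun _ : nat => a k) @ \oo --> b k.
  apply: (@has_sum_coef_cvg nat \oo _ (Num.max Ba Bb) (fun=> a) b (fun=> f) f) => //.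
  - by apply: nearW => _ j; rewrite le_max hA.
  - by move=> j; rewrite le_max hB orbT.
  - exact: nearW.
  - by move=> z; exact: cvg_cst.
exact: cvgC_unique (cvg_cst _) h.
Qed.

Lemma has_sum_mul_lin (b : R) c z L : has_sum (@toC R \o c) z L ->
  has_sum (@toC R \o mul_lin b c) z ((1 + z * toC b) * L).
Proof.
rewrite /has_sum => cL; rewrite -cvg_shiftS /=.
have -> : (fun n => series (fun k => toC (mul_lin b c k) * z ^+ k) n.+1) =
    (fun n => series (fun k => toC (c k) * z ^+ k) n.+1
              + z * toC b * series (fun k => toC (c k) * z ^+ k) n).
  apply/funext; elim => [|n IH].
    rewrite !seriesSr /series /= !big_geq// /mul_lin !expr0 addr0; ring.
  rewrite seriesSr IH !seriesSr /mul_lin rmorphD rmorphM exprS; ring.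
rewrite mulrDl mul1r.
have cS : (fun n => series (fun k => toC (c k) * z ^+ k) n.+1) @ \oo --> L.
  by rewrite cvg_shiftS.
exact: cvgD cS (@cvgMl_tmp _ _ _ _ _ (z * toC b) _ cL).
Qed.

Lemma has_sum_mul_lins (s : seq R) c z L : has_sum (@toC R \o c) z L ->
  has_sum (@toC R \o mul_lins s c) z (\prod_(b <- s) (1 + z * toC b) * L).
Proof.
move=> cL; elim: s => [|b s IH] /=; first by rewrite big_nil mul1r.
by rewrite big_cons -mulrA; exact: has_sum_mul_lin.
Qed.

Lemma dominated_toC S c : (forall k, 0 <= c k) -> (forall k, c k <= exp_coeff S k) ->
  dominated S (@toC R \o c).
Proof. by move=> c0 cS k; rewrite /= nrm_toC ger0_norm. Qed.

Lemma has_sum_exp (t : R) z : has_sum (@toC R \o exp_coeff t) z (expC (toC t * z)).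
Proof.
have dom : dominated `|t| (@toC R \o exp_coeff t).
  by move=> k; rewrite /= nrm_toC /exp_coeff /= normrM normrX [`|_^-1|]ger0_norm// invr_ge0.
have [L tL _] := dominated_has_sum dom z.
rewrite (_ : expC _ = L)//; apply/cvg_lim; first exact: norm_hausdorff.
rewrite /has_sum in tL.
have -> : (fun n => (toC t * z) ^+ n / n`!%:R) = (fun k => (@toC R \o exp_coeff t) k * z ^+ k) => //.
apply/funext => n; rewrite /= /exp_coeff /= rmorphM rmorphXn fmorphV rmorph_nat exprMn; ring.
Qed.

Lemma expC_toC (t : R) : expC (toC t) = toC (expR t).
Proof.
apply/cvg_lim; first exact: norm_hausdorff.
have /cvg_toC := @cvg_series_exp t.
rewrite (_ : (fun _ => _) = series (fun n => toC t ^+ n / n`!%:R))//.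
apply/funext => n; rewrite /series /= rmorph_sum; apply: eq_bigr => k _.
by rewrite /exp_coeff /= rmorphM rmorphXn fmorphV rmorph_nat.
Qed.

End PowerSeries.

(** * Infinite products, their coefficients and their zeros *)

Section Products.
Context {R : realType}.
Local Notation C := (Cplx R).
Local Notation toC := (@toC R).
Implicit Types (z w : C) (x y : nat -> R) (S sigma tau : R).

Lemma spectrum_total S x sigma : spectrum S x sigma ->
  series x @ \oo --> total_mass x /\ total_mass x <= sigma.
Proof.
move=> [_ x0 xs _].
have cx : series x @ \oo --> total_mass x.
  apply: nondecreasing_is_cvgn.
    by apply: nondecreasing_series => n _ _; exact: x0.
  by exists sigma => _ [n _ <-]; exact: xs.
split => //; apply: (@ler_cvg_filter _ _ \oo _ (series x) (fun=> sigma)) => //.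
  exact: cvg_cst.
exact: nearW.
Qed.

Lemma spectrum_params S x sigma : spectrum S x sigma ->
  params S (x, sigma - total_mass x).
Proof.
move=> h; have [cx tx] := spectrum_total h; case: h => xd x0 xs sS.
split=> /=; [split=> //| by rewrite subr_ge0| by rewrite addrC subrK].
  exact: le_trans tx sS.
Qed.

Lemma params_spectrum S (p : (nat -> R) * R) : params S p ->
  spectrum S p.1 (total_mass p.1 + p.2).
Proof.
case: p => x tau [/= [xd x0 cx _] t0 tS]; split => // n.
apply: ler_wpDr => //; apply: nondecreasing_cvgn_le => //.
by apply: nondecreasing_series => j _ _; exact: x0.
Qed.

Lemma has_sum_one z : has_sum (toC \o exp_coeff 0) z 1.
Proof.
rewrite /has_sum -cvg_shiftS.
have -> : (fun n => series (fun k => (toC \o exp_coeff 0) k * z ^+ k) n.+1) = cst 1.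
  apply/funext => n; rewrite /series /= big_nat_recl// big1 ?addr0.
    by rewrite /exp_coeff /= !expr0 divr1 rmorph1 mulr1.
  by move=> i _; rewrite /exp_coeff /= expr0n /= mul0r rmorph0 mul0r.
exact: cvg_cst.
Qed.

(** The series e^{0 z} serves as the constant 1, so that polynomials are the case
    of vanishing exponential mass. *)
Lemma has_sum_fin (s : seq R) z :
  has_sum (toC \o mul_lins s (exp_coeff 0)) z (\prod_(b <- s) (1 + z * toC b)).
Proof. by rewrite -[X in has_sum _ _ X]mulr1; apply: has_sum_mul_lins; exact: has_sum_one. Qed.

Lemma mul_lin_ge (a : R) c k : 0 <= a -> (forall k, 0 <= c k) -> c k <= mul_lin a c k.
Proof. by move=> a0 c0; rewrite /mul_lin lerDl; case: k => // k; rewrite mulr_ge0. Qed.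

Lemma prod_mkseq z x n :
  \prod_(b <- mkseq x n) (1 + z * toC b) = \prod_(0 <= j < n) (1 + z * toC (x j)).
Proof. by rewrite big_map /index_iota subn0. Qed.

(** Partial products are dominated power series whose coefficients increase with
    n, so these converge, and then so do the values. *)
Lemma Dx_cvg S x sigma z : spectrum S x sigma ->
  (fun n => \prod_(0 <= j < n) (1 + z * toC (x j))) @ \oo --> Dx x z.
Proof.
move=> h; case: (h) => xd x0 xs sS.
pose E n := mul_lins (mkseq x n) (exp_coeff 0).
have e0 k : 0 <= exp_coeff (0 : R) k by apply: exp_coeff_ge0.
have E0 n k : 0 <= E n k by apply: mul_lins_ge0 => //; exact: mkseq_ge0.
have EU n k : E n k <= exp_coeff S k.
  apply: le_trans (mul_lins_exp_le (lexx 0) (mkseq_ge0 n x0) k) _.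
  rewrite add0r sum_mkseq; apply: le_exp_coeff; last exact: le_trans (xs n) sS.
  by rewrite /series /= sumr_ge0.
have Ecvg k : exists l : R, (fun n => E n k) @ \oo --> l.
  exists (limn (fun n => E n k)); apply: nondecreasing_is_cvgn; last first.
    by exists (exp_coeff S k) => _ [n _ <-]; exact: EU.
  apply/nondecreasing_seqP => n; rewrite /E -addn1 mkseqD mul_lins_cat.
  apply: mul_lins_le; first exact: mkseq_ge0.
  by move=> j /=; apply: mul_lin_ge.
have [e Ee] := choice Ecvg.
have edom : dominated S (toC \o e).
  apply: dominated_toC => k.
    by apply: ler_cvg_filter (cvg_cst 0) (Ee k) _; exact: nearW.
  by apply: ler_cvg_filter (Ee k) (cvg_cst (exp_coeff S k)) _; exact: nearW.
have [L eL _] := dominated_has_sum edom z.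
suff c : (fun n => \prod_(0 <= j < n) (1 + z * toC (x j))) @ \oo --> L.
  exact: (cvgP _ c).
apply: (@has_sum_cvg_pt _ _ \oo _ S (fun n => toC \o E n) (toC \o e) _ L z _ edom _ eL).
- apply: nearW => n; exact: (dominated_toC (E0 n) (EU n)).
- by apply: nearW => n; rewrite -prod_mkseq; exact: has_sum_fin.
- by move=> k; apply/(cvg_toC _ _); exact: Ee.
Qed.

Lemma spec_coeff_dominated S x sigma : spectrum S x sigma ->
  dominated S (toC \o spec_coeff x sigma).
Proof.
by move=> h; apply: dominated_toC => k; [exact: spec_coeff_ge0 h|exact: spec_coeff_le h].
Qed.

(** The values of the truncations have two expressions: as power series, where
    the coefficients tend to [spec_coeff], and as partial products times
    exponentials. *)
Lemma has_sum_spec S x sigma z : spectrum S x sigma ->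
  has_sum (toC \o spec_coeff x sigma) z (Dxtau x (sigma - total_mass x) z).
Proof.
move=> h; have [cx tx] := spectrum_total h; case: (h) => xd x0 xs sS.
have [L sL _] := dominated_has_sum (spec_coeff_dominated h) z.
suff -> : Dxtau x (sigma - total_mass x) z = L by [].
have au n k : trunc_coeff x sigma n k <= exp_coeff S k.
  apply: le_trans (mul_lins_exp_le _ (mkseq_ge0 n x0) k) _.
    by rewrite subr_ge0.
  by rewrite sum_mkseq subrK; apply: le_exp_coeff => //; exact: spectrum_sigma_ge0 h.
have c1 : (fun n => \prod_(b <- mkseq x n) (1 + z * toC b)
              * expC (toC (sigma - series x n) * z)) @ \oo --> L.
  apply: (@has_sum_cvg_pt _ _ \oo _ S (fun n => toC \o trunc_coeff x sigma n) _ _ _ z) sL _.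
  - apply: nearW => n; apply: dominated_toC => k; last exact: au.
    exact: trunc_coeff_ge0 h.
  - exact: spec_coeff_dominated h.
  - by apply: nearW => n; apply: has_sum_mul_lins; exact: has_sum_exp.
  - by move=> k; apply/(cvg_toC _ _); exact: trunc_coeff_cvg h.
apply: cvgC_unique c1; rewrite /Dxtau mulrC; apply: cvgM.
  under eq_fun do rewrite prod_mkseq.
  exact: Dx_cvg h.
have ed (t : R) : 0 <= t -> t <= S -> dominated S (toC \o exp_coeff t).
  by move=> t0 tS; apply: dominated_toC => k; [exact: exp_coeff_ge0|exact: le_exp_coeff].
apply: (@has_sum_cvg_pt _ _ \oo _ S (fun n => toC \o exp_coeff (sigma - series x n))
  _ _ _ z _ _ _ (@has_sum_exp R (sigma - total_mass x) z)).
- apply: nearW => n; apply: ed; first by rewrite subr_ge0.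
  by apply: le_trans sS; rewrite gerBl /series /= sumr_ge0.
- apply: ed; first by rewrite subr_ge0.
  apply: le_trans sS; rewrite gerBl.
  by apply: ler_cvg_filter (cvg_cst 0) cx _; apply: nearW => n; rewrite /series /= sumr_ge0.
- by apply: nearW => n; exact: has_sum_exp.
- move=> k; apply/(cvg_toC _ _); apply: (@cvg_exp_coeff_param _ _ \oo _ (fun n => sigma - series x n)).
  by apply: cvgB => //; exact: cvg_cst.
Qed.

Lemma has_sum_params S (p : (nat -> R) * R) z : params S p ->
  has_sum (toC \o spec_coeff p.1 (total_mass p.1 + p.2)) z (Dxtau p.1 p.2 z).
Proof.
by move=> /params_spectrum /has_sum_spec - /(_ z); rewrite addrAC subrr add0r.
Qed.

Lemma coefsE (f : C -> C) a : (forall z, has_sum a z (f z)) -> coefs f = a.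
Proof.
move=> af; rewrite /coefs; case: xgetP => [b -> fb|/(_ a)//].
exact: has_sum_inj fb af.
Qed.

Lemma coefs_Dxtau S (p : (nat -> R) * R) : params S p ->
  coefs (Dxtau p.1 p.2) = toC \o spec_coeff p.1 (total_mass p.1 + p.2).
Proof. by move=> h; apply: coefsE => z; exact: has_sum_params h. Qed.

Lemma Dxtau0 x : Dxtau x 0 = Dx x.
Proof.
apply/funext => z; rewrite /Dxtau.
by rewrite -(has_sum_unique (@has_sum_one z) (@has_sum_exp R 0 z)) mul1r.
Qed.

Lemma prod_one_sub_ge (t : nat -> R) m n : (forall j, 0 <= t j <= 1) ->
  1 - \sum_(m <= j < n) t j <= \prod_(m <= j < n) (1 - t j).
Proof.
move=> t01; have [mn|nm] := leqP m n; last by rewrite !big_geq ?subr0// ltnW.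
elim: n mn => [|n IH]; first by rewrite leqn0 => /eqP->; rewrite !big_geq ?subr0.
rewrite leq_eqVlt ltnS => /predU1P[<-|mn]; first by rewrite !big_geq ?subr0.
rewrite !big_nat_recr//=; have /andP[t0 t1] := t01 n.
have /ler_wpM2r h := IH mn; apply: le_trans (h (1 - t n) _); last by rewrite subr_ge0.
have : 0 <= \sum_(m <= j < n) t j by apply: sumr_ge0 => j _; have /andP[] := t01 j.
nra.
Qed.

(** From some index on the r x_j add up to at most 1/2, so the remaining partial
    products stay above 1/2 by [prod_one_sub_ge]; the finitely many other factors
    and the exponential are positive. *)
Lemma Dxtau_neq0 S x sigma r : spectrum S x sigma -> 0 < r -> r * x 0%N < 1 ->
  Dxtau x (sigma - total_mass x) (toC (- r)) != 0.
Proof.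
move=> h r0 rx; have [cx tx] := spectrum_total h; case: (h) => xd x0 xs sS.
rewrite /Dxtau mulf_neq0//.
  rewrite -rmorphM expC_toC; apply/eqP => /(congr1 (@nrm R)).
  by rewrite nrm_toC nrm0 => /normr0P; rewrite expR_eq0.
have rxj j : 0 <= r * x j <= r * x 0%N.
  by rewrite mulr_ge0 ?(ltW r0)//= ler_wpM2l ?(ltW r0)//; exact: xd.
have [M hM] : exists M : nat, r * (total_mass x - series x M) <= 1 / 2.
  have c : (fun n => r * (total_mass x - series x n)) @ \oo --> r * (total_mass x - total_mass x).
    by apply: cvgMl_tmp; apply: cvgB => //; exact: cvg_cst.
  move: c; rewrite subrr mulr0 => /cvgrPdist_le /(_ (1 / 2) ltac:(by rewrite divr_gt0)).
  move=> [M _ /(_ M (leqnn M))] /=; rewrite sub0r normrN => hM.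
  by exists M; exact: le_trans (ler_norm _) hM.
pose q := \prod_(0 <= j < M) (1 - r * x j).
have q0 : 0 < q.
  by apply: prodr_gt0 => j _; rewrite subr_gt0; have /andP[_ /le_lt_trans->] := rxj j.
have low n : (M <= n)%N -> q * (1 / 2) <= \prod_(0 <= j < n) (1 - r * x j).
  move=> Mn; rewrite (big_cat_nat (leq0n M) Mn) /= ler_wpM2l ?(ltW q0)//.
  apply: le_trans (prod_one_sub_ge M n _); last first.
    by move=> j; have /andP[-> /= /le_trans->//] := rxj j; rewrite ltW.
  have : \sum_(M <= j < n) r * x j <= r * (total_mass x - series x M).
    rewrite -mulr_sumr ler_wpM2l ?(ltW r0)// -sub_series_geq// lerD2r.
    apply: nondecreasing_cvgn_le; last exact: cvgP cx.
    by apply: nondecreasing_series => j _ _; exact: x0.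
  by lra.
apply/eqP => D0.
have := @Dx_cvg _ _ _ (toC (- r)) h; rewrite D0 => /cvgC_distP /(_ (q * (1/4))).
move=> /(_ ltac:(by rewrite mulr_gt0// divr_gt0)) [N _ /(_ (maxn N M))].
move=> /(_ (leq_maxl _ _)); rewrite sub0r nrmN.
have -> : \prod_(0 <= j < maxn N M) (1 + toC (- r) * toC (x j)) =
    toC (\prod_(0 <= j < maxn N M) (1 - r * x j)).
  by rewrite rmorph_prod; apply: eq_bigr => j _; rewrite -rmorphM rmorphD rmorph1 mulNr.
have := low _ (leq_maxr N M) => l; rewrite nrm_toC => /(le_trans (ler_norm _)).
move: l q0; lra.
Qed.

(** If y_0 < x_0 then -1/x_0 is a zero of the function of x, but not of that of
    y. *)
Lemma spec_coeff_head_le S x sigma y sigma' :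
  spectrum S x sigma -> spectrum S y sigma' ->
  spec_coeff x sigma = spec_coeff y sigma' -> x 0%N <= y 0%N.
Proof.
move=> hx hy e; rewrite leNgt; apply/negP => yx.
have x0 : 0 < x 0%N by apply: le_lt_trans yx; case: hy.
have r0 : 0 < (x 0%N)^-1 by rewrite invr_gt0.
have /(Dxtau_neq0 hy r0)/eqP : (x 0%N)^-1 * y 0%N < 1.
  by rewrite mulrC ltr_pdivrMr// mul1r.
apply; pose r := toC (- (x 0%N)^-1).
apply: (has_sum_unique (@has_sum_spec _ _ _ r hy)); rewrite -e.
have [hx' ->] := spec_coeff_shift hx.
have r0' : 1 + r * toC (x 0%N) = 0.
  by rewrite /r -rmorphM mulNr mulVf ?gt_eqF// rmorphN rmorph1 subrr.
have hs := @has_sum_mul_lin R (x 0%N) _ _ _ (@has_sum_spec _ _ _ r hx').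
rewrite r0' mul0r in hs; exact: hs.
Qed.

(** Once x_0 = y_0 is known, the factor 1 + x_0 z is cancelled on both sides and
    the argument is repeated for the shifted sequences. *)
Lemma spec_coeff_inj S x sigma y sigma' :
  spectrum S x sigma -> spectrum S y sigma' ->
  spec_coeff x sigma = spec_coeff y sigma' -> x = y /\ sigma = sigma'.
Proof.
move=> hx hy e; split; last by rewrite -(spec_coeff1 x sigma) e spec_coeff1.
apply/funext => j; elim: j x sigma y sigma' hx hy e => [|j IH] x sigma y sigma' hx hy e.
  apply/eqP; rewrite eq_le (spec_coeff_head_le hx hy e).
  by rewrite (spec_coeff_head_le hy hx (esym e)).
have e0 : x 0%N = y 0%N.
  apply/eqP; rewrite eq_le (spec_coeff_head_le hx hy e).
  by rewrite (spec_coeff_head_le hy hx (esym e)).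
have [hx' ex] := spec_coeff_shift hx; have [hy' ey] := spec_coeff_shift hy.
apply: (IH _ _ _ _ hx' hy'); apply: (@mul_lin_inj R (x 0%N)).
by rewrite -ex e ey e0.
Qed.

End Products.

(** * Density of the finite spectra *)

Section Density.
Context {R : realType}.
Local Notation C := (Cplx R).
Local Notation toC := (@toC R).
Implicit Types (z w : C) (x y : nat -> R) (S sigma tau : R) (s : seq R).

Lemma mkseq_nth_pad s m : mkseq (nth 0 s) (size s + m) = s ++ nseq m 0.
Proof.
rewrite mkseqD mkseq_nth; congr (_ ++ _).
have: (size s <= size s)%N by [].
elim: m {2 3}(size s) => //= m IH j sj.
by rewrite nth_default// IH// leqW.
Qed.

Lemma series_nth s n : (size s <= n)%N -> series (nth 0 s) n = \sum_(b <- s) b.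
Proof.
move=> sn; rewrite -sum_mkseq -(subnKC sn) mkseq_nth_pad big_cat /=.
by rewrite [X in _ + X]big1_seq ?addr0// => b /andP[_]; rewrite mem_nseq => /andP[_ /eqP].
Qed.

Lemma prod_nth s z n : (size s <= n)%N ->
  \prod_(0 <= j < n) (1 + z * toC (nth 0 s j)) = \prod_(b <- s) (1 + z * toC b).
Proof.
move=> sn; rewrite -prod_mkseq -(subnKC sn) mkseq_nth_pad big_cat /=.
rewrite [X in _ * X]big1_seq ?mulr1// => b /andP[_].
by rewrite mem_nseq => /andP[_ /eqP->]; rewrite rmorph0 mulr0 addr0.
Qed.

(** The entries must be sorted to form a spectrum; sums and products do not see
    the order. *)
Lemma list_spectrum S s : all (>= 0) s -> \sum_(b <- s) b <= S ->
  exists2 y, finite_spectra S y & forall z, Dx y z = \prod_(b <- s) (1 + z * toC b).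
Proof.
move=> s0 sS; pose s' := sort >=%R s.
have ps : perm_eq s' s by rewrite perm_sort.
have s'0 : all (>= 0) s' by rewrite (perm_all _ ps).
have srt : sorted >=%R s' by apply: sort_sorted => a b; rewrite /= le_total.
have ser_cvg : series (nth 0 s') @ \oo --> \sum_(b <- s) b.
  apply: cvg_near_cst; exists (size s') => // n /= sn.
  by rewrite series_nth//; exact: perm_big.
have y0 j : 0 <= nth 0 s' j.
  have [js|sj] := ltnP j (size s'); last by rewrite nth_default.
  by apply: (allP s'0); exact: mem_nth.
have tot : total_mass (nth 0 s') = \sum_(b <- s) b.
  by apply/cvg_lim; [exact: norm_hausdorff|exact: ser_cvg].
exists (nth 0 s'); last first.
  move=> z; apply/cvg_lim; first exact: norm_hausdorff.
  apply: cvg_near_cst; exists (size s') => // n /= sn.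
  by rewrite prod_nth//; exact: perm_big.
split; first split => //.
- move=> m n mn; have [ns|sn] := ltnP n (size s'); last by rewrite (nth_default _ sn).
  apply: (sorted_leq_nth (leT := >=%R)) => //.
  + by move=> a b c /= ab bc; exact: le_trans bc ab.
  + by move=> a /=.
  + by rewrite inE (leq_ltn_trans mn).
- exact: cvgP ser_cvg.
- by rewrite tot.
apply: (sub_finite_set _ (finite_II (size s'))) => j /=.
by apply: contraNT; rewrite -leqNgt => /(nth_default 0) ->.
Qed.

(** Coefficients are determined by the function, so those of the sorted sequence
    can be computed from the unsorted list. *)
Lemma spec_coeff_list S s y : HS S y ->
  (forall z, Dx y z = \prod_(b <- s) (1 + z * toC b)) ->
  spec_coeff y (total_mass y) = mul_lins s (exp_coeff 0).
Proof.
move=> hy Dy; have py : params S (y, 0).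
  by split=> //=; rewrite addr0; case: hy.
have h z : has_sum (toC \o spec_coeff y (total_mass y)) z (\prod_(b <- s) (1 + z * toC b)).
  by have := @has_sum_params _ _ _ z py; rewrite /= addr0 Dxtau0 Dy.
have e := has_sum_inj h (fun z => @has_sum_fin _ s z).
by apply/funext => k; have /(congr1 (@^~ k)) /= /toC_inj := e.
Qed.

(** Mass t spread over n + 1 equal entries has sum of squares t^2/(n+1), so it
    imitates e^{t z} in the limit. *)
Lemma finite_spectra_dense S (p : (nat -> R) * R) : params S p ->
  exists2 ys : nat -> nat -> R, (forall n, finite_spectra S (ys n)) &
    forall k, spec_coeff (ys n) (total_mass (ys n)) k @[n --> \oo]
      --> spec_coeff p.1 (total_mass p.1 + p.2) k.
Proof.
move=> /params_spectrum; move: (total_mass _ + _) => sigma.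
move: p.1 => x h; have S0 := spectrum_S_ge0 h; case: (h) => xd x0 xs sS.
pose t n := sigma - series x n.
have t0 n : 0 <= t n by rewrite subr_ge0.
have tS n : t n <= S.
  by apply: le_trans sS; rewrite gerBl /series /= sumr_ge0.
(* n.+1 entries rather than n, so that the division is by a nonzero number *)
pose s2 n := nseq n.+1 (t n / n.+1%:R).
pose s n := mkseq x n ++ s2 n.
have s20 n : all (>= 0) (s2 n) by rewrite all_nseq divr_ge0 ?orbT.
have s0 n : all (>= 0) (s n) by rewrite all_cat mkseq_ge0 ?s20.
have n0 n : n.+1%:R != 0 :> R by rewrite pnatr_eq0.
have s2s n : \sum_(b <- s2 n) b = t n.
  by rewrite big_nseq iter_addr_0 -(mulr_natr (t n / _)) divfK.
have s2q n : sqsum (s2 n) <= S ^+ 2 / n.+1%:R.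
  rewrite /sqsum big_nseq iter_addr_0 -(mulr_natr (_ ^+ 2)).
  have -> : (t n / n.+1%:R) ^+ 2 * n.+1%:R = t n ^+ 2 / n.+1%:R.
    by field.
  by rewrite ler_wpM2r ?invr_ge0//; apply: lerXn2r; rewrite ?nnegrE.
have ss n : \sum_(b <- s n) b = sigma.
  by rewrite big_cat /= sum_mkseq s2s /t addrC subrK.
have /choice[ys hys] n : exists y, finite_spectra S y /\
    spec_coeff y (total_mass y) = mul_lins (s n) (exp_coeff 0).
  have [|y fy Dy] := @list_spectrum S (s n) (s0 n); first by rewrite ss.
  by exists y; split => //; exact: (spec_coeff_list fy.1 Dy).
exists ys => [n|k]; first by case: (hys n).
under eq_fun do rewrite (hys _).2.
pose E n : R := S ^+ 2 / n.+1%:R * shift2 (exp_coeff S) k.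
have bnd n : trunc_coeff x sigma n k - E n <= mul_lins (s n) (exp_coeff 0) k
    <= trunc_coeff x sigma n k.
  have leS : 0 + \sum_(b <- s2 n) b + \sum_(b <- mkseq x n) b <= S.
    by rewrite add0r s2s sum_mkseq subrK.
  have := mul_lins_block k (lexx 0) (mkseq_ge0 n x0) (s20 n) leS.
  rewrite add0r s2s => /andP[h1 h2]; rewrite {2}/trunc_coeff h1 andbT lerBlDr.
  apply: le_trans h2 _; rewrite lerD2l ler_wpM2r//.
  by apply: shift2_ge0 => j; rewrite exp_coeff_ge0.
have tc := @trunc_coeff_cvg _ _ _ _ k h.
apply: (squeeze_cvgr _ _ tc); first exact: nearW bnd.
rewrite -[X in _ --> X]subr0; apply: cvgB tc _.
rewrite -(mul0r (shift2 (exp_coeff S) k)) -(mulr0 (S ^+ 2)).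
by apply: cvgMr_tmp; apply: cvgMl_tmp; exact: cvg_harmonic.
Qed.

End Density.

(** * Parameters as continuous functions of the coefficients *)

Section Homeomorphism.
Context {R : realType}.

(** A set that is not in the filter has a complement that meets all its members,
    hence belongs to a finer ultrafilter. *)
Lemma cvg_ultra T (U : topologicalType) (F : set_system T) {FF : Filter F}
    (f : T -> U) (l : U) :
  (forall G : set_system T, UltraFilter G -> F `<=` G -> f @ G --> l) -> f @ F --> l.
Proof.
move=> h A lA; apply: contrapT => nFA.
have PF : ProperFilter (within (~` (f @^-1` A)) F).
  split; last exact: within_filter.
  by rewrite /within /= => F0; apply: nFA; apply: filterS F0 => t /= /contrapT.
have [G [GU sG]] := ultraFilterLemma PF.
have FG : F `<=` G by move=> B FB; apply: sG; apply: filterS FB.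
have GA : G (f @^-1` A) := h G GU FG A lA.
have GnA : G (~` (f @^-1` A)) by apply: sG; rewrite /within /=; exact: filterE.
by have [t []] := filter_ex (filterI GA GnA).
Qed.

(** The inverse of a continuous injection of a compact space is continuous:
    along each finer ultrafilter the parameters have some limit, and injectivity
    identifies it. *)
Lemma cvg_spec_coeff_inv T (F : set_system T) {FF : Filter F} S
    (xs : T -> nat -> R) (sigmas : T -> R) (x : nat -> R) (sigma : R) :
  (\forall t \near F, spectrum S (xs t) (sigmas t)) -> spectrum S x sigma ->
  (forall k, spec_coeff (xs t) (sigmas t) k @[t --> F] --> spec_coeff x sigma k) ->
  (forall j, xs t j @[t --> F] --> x j) /\ sigmas @ F --> sigma.
Proof.
move=> hs h cv; split; last first.
  by have := cv 1%N; rewrite spec_coeff1; under eq_fun do rewrite spec_coeff1.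
move=> j; apply: cvg_ultra => G GU sFG.
have hsG : \forall t \near G, spectrum S (xs t) (sigmas t) by exact: sFG.
have [y [sigma' [hy yc sc]]] := spectrum_compact GU hsG.
have e : spec_coeff x sigma = spec_coeff y sigma'.
  apply/funext => k.
  have c1 : spec_coeff (xs t) (sigmas t) k @[t --> G] --> spec_coeff y sigma' k.
    exact: cvg_spec_coeff hsG hy yc sc k.
  have c2 : spec_coeff (xs t) (sigmas t) k @[t --> G] --> spec_coeff x sigma k.
    by move=> A /cv; exact: sFG.
  exact: norm_cvg_unique c2 c1.
by have [-> _] := spec_coeff_inj h hy e; exact: yc.
Qed.

End Homeomorphism.

(** * Closures in the function and coefficient spaces *)

Section FunctionSpaces.
Context {R : realType}.
Local Notation C := (Cplx R).
Local Notation toC := (@toC R).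
Implicit Types (S : R) (f : C -> C).

Lemma exp_coeff_le_exp S k : 0 <= S -> exp_coeff S k <= expR S.
Proof.
move=> S0; have u0 j : 0 <= exp_coeff S j by exact: exp_coeff_ge0.
apply: (@le_trans _ _ (series (exp_coeff S) k.+1)).
  by rewrite seriesSr lerDr /series /= sumr_ge0.
apply: nondecreasing_cvgn_le; last exact: is_cvg_series_exp_coeff.
by apply: nondecreasing_series => j _ _; exact: u0.
Qed.

Lemma DS_coefs S f : DS S f ->
  dominated S (coefs f) /\ forall z, has_sum (coefs f) z (f z).
Proof.
move=> [p hp <-]; rewrite (coefs_Dxtau hp); split.
  exact: spec_coeff_dominated (params_spectrum hp).
by move=> z; exact: (@has_sum_params _ _ _ z hp).
Qed.

Lemma DS_S_ge0 S f : DS S f -> 0 <= S.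
Proof. by move=> [p /params_spectrum/spectrum_S_ge0]. Qed.

Lemma cvg_nrm T (F : set_system T) {FF : Filter F} (g : T -> C) (l : C) :
  g @ F --> l -> nrm (g t) @[t --> F] --> nrm l.
Proof.
move=> /cvgC_distP gl; apply/cvgrPdist_le => e e0.
apply: filterS (gl e e0) => t; apply: le_trans.
rewrite ler_norml lerBlDr lerNl opprB lerBlDr; apply/andP; split.
  by rewrite nrmB -{1}(subrK l (g t)) nrmD.
by rewrite -{1}(subrK (g t) l) nrmD.
Qed.

Lemma compact_nrm_bounded (A : set C) : compact A ->
  exists rho : R, forall z, A z -> nrm z <= rho.
Proof.
move=> cA; have cn : continuous (@nrm R : C -> R).
  by move=> z; apply: (@cvg_nrm _ (nbhs z) _ id); exact: cvg_id.
have /compact_bounded[M [_ hM]] : compact ((@nrm R : C -> R) @` A).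
  by apply: continuous_compact => //; exact: continuous_subspaceT.
exists (M + 1) => z Az; apply: le_trans (ler_norm _) _.
by apply: (hM (M + 1)); [rewrite ltrDl|exists z].
Qed.

(** Pointwise convergence suffices, since the class has bounded coefficients. *)
Lemma ptws_coefs_cvg S (F : set_system (C -> C)) f : Filter F -> F (DS S) -> DS S f ->
  (forall z, g z @[g --> F] --> f z) -> forall k, coefs g k @[g --> F] --> coefs f k.
Proof.
move=> FF FDS Df cv; have S0 := DS_S_ge0 Df; have [dom sum] := DS_coefs Df.
have bd a k : dominated S a -> nrm (a k) <= expR S.
  by move=> da; exact: le_trans (da k) (exp_coeff_le_exp k S0).
apply: (@has_sum_coef_cvg _ _ F _ (expR S) (fun g => coefs g) _ (fun g => g) f _ _ _ sum cv).
- apply: filterS FDS => g Dg k; apply: bd; exact: (DS_coefs Dg).1.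
- by move=> k; exact: bd.
- by apply: filterS FDS => g Dg; exact: (DS_coefs Dg).2.
Qed.

(** A compact set lies in a disc, where the convergence is uniform. *)
Lemma coefs_family_cvg S (F : set_system (C -> C)) f : Filter F -> F (DS S) -> DS S f ->
  (forall k, coefs g k @[g --> F] --> coefs f k) -> {family compact, F --> f}.
Proof.
move=> FF FDS Df cv; have [dom sum] := DS_coefs Df.
apply/fam_cvgP => A /compact_nrm_bounded[rho hrho] P /uniform_nbhs[E [entE EP]].
move: entE; rewrite -entourage_ballE => -[_ /= /gt0_toC[e e0 ->] eE].
have e20 : 0 < e / 2 by rewrite divr_gt0.
have h := @has_sum_cvg_uniform _ _ F _ S rho (e / 2) (fun g => coefs g) (coefs f)
   (fun g => g) f _ dom _ sum cv e20.
suff : F [set g : C -> C | forall z, nrm z <= rho -> nrm (f z - g z) <= e / 2].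
  apply: filterS => g hg; apply: EP => z Az; apply: eE => /=.
  rewrite /ball /= normCE toC_lt; apply: le_lt_trans (hg z (hrho z Az)) _.
  by rewrite ltr_pdivrMr// ltr_pMr// ltr1n.
apply: h.
- by apply: filterS FDS => g Dg; exact: (DS_coefs Dg).1.
- by apply: filterS FDS => g Dg; exact: (DS_coefs Dg).2.
Qed.

Lemma family_ptws (F : set_system (C -> C)) f : Filter F ->
  {family compact, F --> f} -> forall z, g z @[g --> F] --> f z.
Proof. by move=> FF /pointwise_cvg_compact_family /pointwise_cvgP. Qed.

Lemma HS_params S x : HS S x -> params S (x, 0).
Proof. by move=> hx; split => //=; rewrite addr0; case: hx. Qed.

Lemma HS_DS S x : HS S x -> DS S (Dx x).
Proof. by move=> /HS_params hx; exists (x, 0) => //=; rewrite Dxtau0. Qed.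

Lemma coefs_Dx S x : HS S x -> coefs (Dx x) = toC \o spec_coeff x (total_mass x).
Proof. by move=> /HS_params /coefs_Dxtau /=; rewrite Dxtau0 addr0. Qed.

(** Compactness in its ultrafilter form, transported to the coefficients. *)
Lemma spectra_ultra_limit T (F : set_system T) S (xs : T -> nat -> R) :
  UltraFilter F -> (\forall t \near F, HS S (xs t)) ->
  exists2 p, params S p &
    forall k, coefs (Dx (xs t)) k @[t --> F] --> coefs (Dxtau p.1 p.2) k.
Proof.
move=> FU hF.
have hs : \forall t \near F, spectrum S (xs t) (total_mass (xs t)).
  by apply: filterS hF => t /HS_params/params_spectrum /=; rewrite addr0.
have [x [sigma [hx xc sc]]] := spectrum_compact FU hs.
exists (x, sigma - total_mass x); first exact: spectrum_params.
move=> k; rewrite (coefs_Dxtau (spectrum_params hx)) /= addrC subrK.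
have /cvg_toC c' : (fun t => spec_coeff (xs t) (total_mass (xs t)) k) @ F --> spec_coeff x sigma k.
  exact: cvg_spec_coeff hs hx xc sc _.
apply: cvg_trans c'; apply: near_eq_cvg.
by apply: filterS hF => t /coefs_Dx ->.
Qed.

Lemma params_limit S p : params S p ->
  exists2 ys : nat -> nat -> R, (forall n, finite_spectra S (ys n)) &
    forall k, coefs (Dx (ys n)) k @[n --> \oo] --> coefs (Dxtau p.1 p.2) k.
Proof.
move=> hp; have [ys fys cv] := finite_spectra_dense hp; exists ys => // k.
rewrite (coefs_Dxtau hp); under eq_fun do rewrite (coefs_Dx (fys _).1).
by apply/(cvg_toC _ _); exact: cv.
Qed.

(** A point of the closure is the limit of an ultrafilter on the set; choosing
    parameters for its members reduces to [spectra_ultra_limit]. *)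
Lemma closure_Dx S :
  closure ([set Dx x | x in HS S] : set {family compact, C -> C}) = DS S.
Proof.
apply/seteqP; split => f.
  rewrite closureEcvg => -[G PG [Gf sG]].
  have [U [UU sGU]] := ultraFilterLemma PG.
  have UA : U [set Dx x | x in HS S] by apply: sGU; apply: sG.
  have ex (g : C -> C) : exists x, [set Dx x | x in HS S] g -> HS S x /\ Dx x = g.
    by have [[x hx xg]|ng] := pselect ([set Dx x | x in HS S] g); [exists x|exists (fun=> 0)].
  have [sx hsx] := choice ex.
  have hU : \forall g \near U, HS S (sx g).
    by apply: filterS UA => g /hsx[].
  have [p hp cv] := spectra_ultra_limit UU hU.
  suff -> : f = Dxtau p.1 p.2 by exists p.
  apply/funext => z.
  have c1 : (g : C -> C) z @[g --> U] --> f z.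
    apply: (@family_ptws U f _ _ z).
    exact: cvg_trans sGU Gf.
  apply: (cvgC_unique c1).
  apply: (@has_sum_cvg_pt _ _ U _ S (fun g => coefs (Dx (sx g))) _ _ _ z _ _ _
    (@has_sum_params _ _ _ z hp)).
  - by apply: filterS hU => g /HS_DS/DS_coefs[].
  - exact: spec_coeff_dominated (params_spectrum hp).
  - apply: filterS UA => g /hsx[hg {2}<-].
    exact: (DS_coefs (HS_DS hg)).2.
  - by move=> k; rewrite -(coefs_Dxtau hp); exact: cv.
move=> [p hp <-]; have [ys fys cv] := params_limit hp.
have h : {family compact, (fun n => Dx (ys n)) @ \oo --> Dxtau p.1 p.2}.
  have FD : ((fun n => Dx (ys n)) @ \oo) (DS S).
    by exists 0%N => // n _; exact: HS_DS (fys n).1.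
  have Dp : DS S (Dxtau p.1 p.2) by exists p.
  exact: (coefs_family_cvg _ FD Dp cv).
move=> B /h [N _ hN]; exists (Dx (ys N)); split; last exact: (hN N (leqnn N)).
by exists (ys N) => //; exact: (fys N).1.
Qed.

Lemma closure_coefs S :
  closure ([set coefs (Dx x) | x in finite_spectra S] : set {ptws nat -> C})
  = [set coefs f | f in DS S].
Proof.
apply/seteqP; split => a.
  rewrite closureEcvg => -[G PG [Ga sG]].
  have [U [UU sGU]] := ultraFilterLemma PG.
  have UA : U [set coefs (Dx x) | x in finite_spectra S] by apply: sGU; apply: sG.
  have ex (b : nat -> C) : exists x, [set coefs (Dx x) | x in finite_spectra S] b ->
      HS S x /\ coefs (Dx x) = b.
    have [[x [hx _] xb]|nb] := pselect ([set coefs (Dx x) | x in finite_spectra S] b).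
      by exists x.
    by exists (fun=> 0).
  have [sx hsx] := choice ex.
  have hU : \forall b \near U, HS S (sx b).
    by apply: filterS UA => b /hsx[].
  have [p hp cv] := spectra_ultra_limit UU hU.
  exists (Dxtau p.1 p.2); first by exists p.
  apply/funext => k.
  have c1 : (b : nat -> C) k @[b --> U] --> a k.
    have Ua : {ptws, U --> a} by exact: cvg_trans sGU Ga.
    by have /(@pointwise_cvgP nat C U a _) := Ua; apply.
  apply: (cvgC_unique (cv k)); apply: cvg_trans c1; apply: near_eq_cvg.
  by apply: filterS UA => b /hsx[_ ->].
move=> [f [p hp <-] <-]; have [ys fys cv] := params_limit hp.
have h : {ptws, (fun n => coefs (Dx (ys n))) @ \oo --> coefs (Dxtau p.1 p.2)}.
  by apply/pointwise_cvgP => k; exact: cv.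
move=> B /h [N _ hN]; exists (coefs (Dx (ys N))); split; last exact: (hN N (leqnn N)).
by exists (ys N).
Qed.

Lemma Dxtau_inj S (p q : (nat -> R) * R) : params S p -> params S q ->
  Dxtau p.1 p.2 = Dxtau q.1 q.2 -> p = q.
Proof.
move=> hp hq e; have := coefs_Dxtau hp; rewrite e (coefs_Dxtau hq) => ec.
have es : spec_coeff q.1 (total_mass q.1 + q.2) = spec_coeff p.1 (total_mass p.1 + p.2).
  by apply/funext => k; have /(congr1 (@^~ k)) /= /toC_inj := ec.
have [e1 e2] := spec_coeff_inj (params_spectrum hq) (params_spectrum hp) es.
by rewrite (surjective_pairing p) (surjective_pairing q) -e1; congr (_, _); move: e2; rewrite e1 => /addrI.
Qed.

Lemma family_coefs_iff S (F : set_system (C -> C)) f :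
  ProperFilter F -> F (DS S) -> DS S f ->
  ({family compact, F --> f} <-> {ptws, coefs @ F --> coefs f}).
Proof.
move=> PF FDS Df; split.
  move=> /family_ptws h; apply/pointwise_cvgP => k.
  exact: (ptws_coefs_cvg _ FDS Df h).
move=> /pointwise_cvgP h; apply: (coefs_family_cvg _ FDS Df) => k.
exact: h.
Qed.

End FunctionSpaces.

(** * Tails and the l^1 distance *)

Section Tails.
Context {R : realType}.
Implicit Types (x : nat -> R) (S tau : R).

Lemma tail_massE x M : cvgn (series x) -> tail_mass M x = total_mass x - series x M.
Proof.
move=> cx; apply/cvg_lim; first exact: norm_hausdorff.
have c : (fun n => series x n - series x M) @ \oo --> total_mass x - series x M.
  by apply: cvgB; [exact: cx|exact: cvg_cst].
apply: cvg_trans c; apply: near_eq_cvg; exists M => // n /= Mn.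
by rewrite sub_series_geq.
Qed.

Lemma HS_cvg S x : HS S x -> cvgn (series x).
Proof. by case. Qed.

Lemma HS_series_le S x n : HS S x -> series x n <= total_mass x.
Proof.
move=> [_ x0 cx _]; apply: nondecreasing_cvgn_le => //.
by apply: nondecreasing_series => j _ _; exact: x0.
Qed.

Lemma tail_mass_ge0 S x M : HS S x -> 0 <= tail_mass M x.
Proof. by move=> h; rewrite (tail_massE _ (HS_cvg h)) subr_ge0 (HS_series_le M h). Qed.

Lemma tail_mass_nonincreasing S x M N : HS S x -> (M <= N)%N ->
  tail_mass N x <= tail_mass M x.
Proof.
move=> h MN; rewrite !(tail_massE _ (HS_cvg h)) lerB//.
by apply: nondecreasing_series => // j _ _; case: h.
Qed.

Lemma tail_mass_le S x M : HS S x -> tail_mass M x <= S.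
Proof.
move=> h; apply: le_trans (tail_mass_nonincreasing h (leq0n M)) _; by case: h.
Qed.

Lemma tail_mass_cvg0 x : cvgn (series x) -> tail_mass M x @[M --> \oo] --> (0 : R).
Proof.
move=> cx; under eq_fun do rewrite tail_massE//.
by rewrite -(subrr (total_mass x)); apply: cvgB; [exact: cvg_cst|exact: cx].
Qed.

Lemma near_forall_ltn (P : nat -> nat -> Prop) L :
  (forall l, \forall M \near \oo, P l M) ->
  \forall M \near \oo, forall l, (l < L)%N -> P l M.
Proof.
move=> h; elim: L => [|L IH]; first exact: nearW.
near=> M => l; rewrite ltnS leq_eqVlt => /predU1P[->|].
  by near: M; exact: h.
by move: l; near: M.
Unshelve. all: by end_near. Qed.

Section Limit.
Context (S : R) (xs : nat -> nat -> R) (x : nat -> R) (tau : R).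
Context (hxs : forall l, HS S (xs l)) (hx : HS S x) (tau0 : 0 <= tau).
Context (xs_cvg : forall j, xs l j @[l --> \oo] --> x j).
Context (total_cvg : total_mass (xs l) @[l --> \oo] --> total_mass x + tau).

(** The mass lost in the limit lies beyond every fixed index M. *)
Lemma tail_mass_cvg M : tail_mass M (xs l) @[l --> \oo] --> tau + tail_mass M x.
Proof.
under eq_fun do rewrite (tail_massE _ (HS_cvg (hxs _))).
rewrite (tail_massE _ (HS_cvg hx)) addrA (addrC tau).
by apply: cvgB => //; exact: cvg_series_fin.
Qed.

Lemma sup_tail_ge l M : tail_mass M (xs l) <= sup (range (fun l => tail_mass M (xs l))).
Proof.
apply: ub_le_sup; last by exists l.
by exists S => _ [n _ <-]; exact: tail_mass_le.
Qed.

(** A tail beyond a fixed M0 is small for all but finitely many l, and each of the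
    remaining l has small tails beyond an index of its own. *)
Lemma tau0_sup_tail : tau = 0 <->
  sup (range (fun l => tail_mass M (xs l))) @[M --> \oo] --> (0 : R).
Proof.
split=> [t0|sup0]; last first.
  apply/eqP; rewrite eq_le tau0 andbT.
  apply: (ler_cvg_filter (cvg_cst tau) sup0); apply: nearW => M.
  apply: (@le_trans _ _ (tau + tail_mass M x)); first by rewrite lerDl (tail_mass_ge0 _ hx).
  apply: (ler_cvg_filter (@tail_mass_cvg M) (cvg_cst (sup _))).
  by apply: nearW => l; exact: sup_tail_ge.
apply/cvgrPdist_le => e e0.
have e20 : 0 < e / 2 by rewrite divr_gt0.
have /cvgrPdist_le /(_ _ e20) [M0 _ /(_ M0 (leqnn _))] := tail_mass_cvg0 (HS_cvg hx).
rewrite /= sub0r normrN => /(le_trans (ler_norm _)) tM0.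
have /cvgrPdist_le /(_ _ e20) [L _ hL] := @tail_mass_cvg M0.
have late l : (L <= l)%N -> tail_mass M0 (xs l) <= e.
  move=> /hL /=; rewrite t0 add0r distrC => /(le_trans (ler_norm _)).
  by rewrite lerBlDr => /le_trans; apply; rewrite [leRHS](splitr e) lerD2l.
have early : \forall M \near \oo, forall l, (l < L)%N -> tail_mass M (xs l) <= e.
  apply: near_forall_ltn => l.
  have /cvgrPdist_le /(_ _ e0) := tail_mass_cvg0 (HS_cvg (hxs l)).
  by apply: filterS => M; rewrite sub0r normrN => /(le_trans (ler_norm _)).
near=> M.
rewrite sub0r normrN ger0_norm; last first.
  exact: le_trans (tail_mass_ge0 M (hxs 0)) (sup_tail_ge 0 M).
apply: ge_sup; first by exists (tail_mass M (xs 0)); exists 0%N.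
move=> _ [l _ <-]; have [lL|Ll] := ltnP l L.
  by move: l lL; near: M.
apply: le_trans (late l Ll); apply: (tail_mass_nonincreasing (hxs l)).
by near: M; exists M0.
Unshelve. all: by end_near. Qed.

Let dist l j := `|xs l j - x j|.

Lemma dist_cvg l : cvgn (series (dist l)).
Proof.
apply: (@series_le_cvg _ _ (fun j => xs l j + x j)) => [j|j|j|].
- exact: normr_ge0.
- by rewrite addr_ge0//; [case: (hxs l)|case: hx].
- apply: le_trans (ler_normB _ _) _.
  by rewrite !ger0_norm//; [case: hx|case: (hxs l)].
- exact: is_cvg_seriesD (HS_cvg (hxs l)) (HS_cvg hx).
Qed.

(** Cut at M: finitely many coordinates, and two tails bounded separately. *)
Lemma dist_total_le l M :
  total_mass (dist l) <= series (dist l) M + (tail_mass M (xs l) + tail_mass M x).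
Proof.
apply: limr_le; first exact: dist_cvg.
exists M => // n /= Mn; rewrite (tail_massE _ (HS_cvg hx)) (tail_massE _ (HS_cvg (hxs l))).
rewrite -[X in X <= _](subrK (series (dist l) M)) addrC lerD2l.
apply: (@le_trans _ _ ((series (xs l) n - series (xs l) M) + (series x n - series x M))).
  rewrite !sub_series_geq// -big_split /=; apply: ler_sum => j _.
  apply: le_trans (ler_normB _ _) _.
  by rewrite !ger0_norm//; [case: hx|case: (hxs l)].
by apply: lerD; rewrite lerD2r; apply: HS_series_le; [exact: hxs|exact: hx].
Qed.

Lemma dist_total_ge l : `|total_mass (xs l) - total_mass x| <= total_mass (dist l).
Proof.
have c : (fun n => `|series (xs l) n - series x n|) @ \oo --> `|total_mass (xs l) - total_mass x|.
  by apply: cvg_norm; apply: cvgB; [exact: HS_cvg (hxs l)|exact: HS_cvg hx].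
apply: (ler_cvg_filter c (@dist_cvg l)); apply: nearW => n.
by rewrite /series /= -sumrB; exact: ler_norm_sum.
Qed.

Lemma tau0_l1 : tau = 0 <-> total_mass (dist l) @[l --> \oo] --> (0 : R).
Proof.
split=> [t0|d0]; last first.
  have c : total_mass (xs l) @[l --> \oo] --> total_mass x.
    apply/cvgrPdist_le => e e0; move/cvgrPdist_le: d0 => /(_ e e0).
    apply: filterS => l; rewrite sub0r normrN => /(le_trans (ler_norm _)).
    by rewrite distrC; apply: le_trans; exact: dist_total_ge.
  have e : total_mass x + tau = total_mass x := norm_cvg_unique total_cvg c.
  by rewrite -[tau](addKr (total_mass x)) e addNr.
apply/cvgrPdist_le => e e0.
have e40 : 0 < e / 4 by rewrite divr_gt0.
have /cvgrPdist_le /(_ _ e40) [M _ /(_ M (leqnn _))] := tail_mass_cvg0 (HS_cvg hx).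
rewrite /= sub0r normrN => /(le_trans (ler_norm _)) tM.
have /cvgrPdist_le /(_ _ e40) tl := @tail_mass_cvg M.
have : series (dist l) M @[l --> \oo] --> series (fun=> 0 : R) M.
  apply: cvg_series_fin => j; rewrite -(normr0 R) -(subrr (x j)).
  by apply: cvg_norm; apply: cvgB => //; exact: cvg_cst.
rewrite [X in _ --> X]/series /= big1_eq => /cvgrPdist_le /(_ _ e40) sl.
near=> l; rewrite sub0r normrN ger0_norm; last first.
  exact: le_trans (normr_ge0 _) (dist_total_ge l).
apply: le_trans (dist_total_le l M) _.
have h1 : `|0 - series (dist l) M| <= e / 4 by near: l.
have h2 : `|tau + tail_mass M x - tail_mass M (xs l)| <= e / 4 by near: l.
move: h1; rewrite sub0r normrN => /(le_trans (ler_norm _)).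
move: h2; rewrite t0 add0r distrC => /(le_trans (ler_norm _)).
move: (series _ _) (tail_mass M (xs l)) (tail_mass M x) tM => p q r; lra.
Unshelve. all: by end_near. Qed.

End Limit.
End Tails.

Theorem theorem10p14 (R : realType) (S : R) (S_gt0 : 0 < S) :
  [/\ closure ([set Dx x | x in HS S]
                 : set {family compact, Cplx R -> Cplx R}) = DS S,
      forall p q : (nat -> R) * R, params S p -> params S q ->
        Dxtau p.1 p.2 = Dxtau q.1 q.2 -> p = q,
      closure ([set coefs (Dx x) | x in finite_spectra S]
                 : set {ptws nat -> Cplx R}) = [set coefs f | f in DS S],
      forall (F : set_system (Cplx R -> Cplx R)) (f : Cplx R -> Cplx R),
        ProperFilter F -> F (DS S) -> DS S f ->
        ({family compact, F --> f} <-> {ptws, coefs @ F --> coefs f})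
    & forall (xs : nat -> nat -> R) (x : nat -> R) (tau : R),
        (forall l, HS S (xs l)) -> params S (x, tau) ->
        {family compact, (fun l => Dx (xs l)) @ \oo --> Dxtau x tau} ->
        [/\ forall j, (fun l => xs l j) @ \oo --> x j,
            cvgn (fun l => total_mass (xs l)) /\
              tau = limn (fun l => total_mass (xs l)) - total_mass x,
            (forall M, cvgn (fun l => tail_mass M (xs l))) /\
              (fun M => limn (fun l => tail_mass M (xs l))) @ \oo --> tau,
            tau = 0 <->
              (fun M => sup (range (fun l => tail_mass M (xs l)))) @ \oo --> (0 : R)
          & tau = 0 <->
              (fun l => total_mass (fun j => `|xs l j - x j|)) @ \oo --> (0 : R)]].
Proof.
split.
- exact: closure_Dx.
- exact: Dxtau_inj.
- exact: closure_coefs.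
- exact: family_coefs_iff.
move=> xs x tau hxs hp cv.
have hx : HS S x by case: hp.
have tau0 : 0 <= tau by case: hp.
have Dp : DS S (Dxtau x tau) by exists (x, tau).
have FD : ((fun l => Dx (xs l)) @ \oo) (DS S) by exists 0%N => // l _; exact: HS_DS (hxs l).
have cc k : coefs (Dx (xs l)) k @[l --> \oo] --> coefs (Dxtau x tau) k.
  exact: (ptws_coefs_cvg _ FD Dp (family_ptws _ cv)).
have sc k : spec_coeff (xs l) (total_mass (xs l)) k @[l --> \oo]
    --> spec_coeff x (total_mass x + tau) k.
  apply/cvg_toC; have := cc k; rewrite (coefs_Dxtau hp) /=.
  apply: cvg_trans; apply: near_eq_cvg; apply: nearW => l /=.
  by rewrite (coefs_Dx (hxs l)).
have hs : \forall l \near \oo, spectrum S (xs l) (total_mass (xs l)).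
  by apply: nearW => l; have := params_spectrum (HS_params (hxs l)); rewrite /= addr0.
have [xc tc] := cvg_spec_coeff_inv hs (params_spectrum hp) sc.
have lt : limn (fun l => total_mass (xs l)) = total_mass x + tau.
  by apply/cvg_lim; [exact: norm_hausdorff|exact: tc].
have tlc M := tail_mass_cvg hxs hx xc tc M.
split.
- exact: xc.
- by split; [exact: cvgP tc|rewrite lt addrAC subrr add0r].
- split=> [M|]; first exact: cvgP (tlc M).
  have -> : (fun M => limn (fun l => tail_mass M (xs l))) = (fun M => tau + tail_mass M x).
    by apply/funext => M; apply/cvg_lim; [exact: norm_hausdorff|exact: tlc].
  rewrite -[X in _ --> X]addr0; apply: cvgD; first exact: cvg_cst.
  exact: tail_mass_cvg0 (HS_cvg hx).
- exact: (tau0_sup_tail hxs hx tau0 xc tc).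
- exact: (tau0_l1 hxs hx xc tc).
Qed.
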